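(* Let $k$ be a finite field, let $n\ge 1$, and let $\mathcal{T}_n$ be the category of finite-dimensional nilpotent $k$-representations of the opposite $\Delta_n^{\mathrm{op}}$ of the cyclic quiver $\Delta_n$. For a discrete stability function $Z:G_0(\mathcal{T}_n)\to\mathbb{C}$ on $\mathcal{T}_n$ define $$\mathbb{E}_Z:=\prod^{\curvearrowright}_{L\ \text{stable},\ \underline{\dim}\,L\ne\delta}\mathbb{E}(y^{\underline{\dim}\,L})\in\hat{\mathbb{T}}_{\Delta_n},$$ where $\delta=(1,1,\dots,1)$, $L$ runs over the isomorphism classes of $Z$-stable objects of $\mathcal{T}_n$ with $\underline{\dim}\,L\neq\delta$ (there are finitely many), and the factors are multiplied from left to right in the order of decreasing phases. Then $\mathbb{E}_Z$ does not depend on the choice of the discrete stability function $Z$; that is, $\mathbb{E}_Z=\mathbb{E}_{Z'}$ for any two discrete stability functions $Z,Z'$ on $\mathcal{T}_n$.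
   Context: The cyclic quiver $\Delta_n$ has vertex set $Q_0=\{1,\dots,n\}$ and one arrow from $i$ to $i+1$ for each $i$ (indices modulo $n$). $S_i$ denotes the simple representation of $\Delta_n^{\mathrm{op}}$ (the quiver with arrows $i+1\to i$) at the vertex $i$. The category $\mathcal{T}_n$ is a hereditary abelian category in which every indecomposable object is uniserial and determined up to isomorphism by its socle and its length; the indecomposable of length $2$ with socle $S_i$ has top $S_{i+1}$. Its Grothendieck group is $G_0(\mathcal{T}_n)=\bigoplus_{i=1}^n\mathbb{Z}[S_i]\cong\mathbb{Z}^n$, and the class $[X]$ of an object $X$ corresponds to its dimension vector $\underline{\dim}\,X$. Stability: a stability function on an abelian category $\mathcal{A}$ is a group homomorphism $Z:G_0(\mathcal{A})\to\mathbb{C}$ such that for each nonzero object $X$ the number $Z([X])$ is nonzero and has argument $\arg Z([X])\in[0,\pi)$; this argument is called the phase of $X$. A nonzero object $X$ is ($Z$-)stable (resp. semi-stable) if every nonzero proper subobject $Y$ of $X$ satisfies $\arg Z([Y])<\arg Z([X])$ (resp. $\le$). For $\mu\in[0,\pi)$, $\mathcal{A}_\mu$ denotes the full subcategory of the zero object and the semi-stable objects of phase $\mu$; it is an abelian subcategory whose simple objects are the stable objects of phase $\mu$. $Z$ is discrete if each $\mathcal{A}_\mu$ is zero or has a unique simple object up to isomorphism (equivalently, non-isomorphic stable objects have different phases). Quantum torus: let $\chi([M],[N])=\dim_k\mathrm{Hom}(M,N)-\dim_k\mathrm{Ext}^1(M,N)$ be the Euler form on $G_0(\mathcal{T}_n)$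 and $\lambda([M],[N])=\chi([M],[N])-\chi([N],[M])$ its antisymmetrization. Let $q$ be an indeterminate. The completed quantum torus $\hat{\mathbb{T}}_{\Delta_n}=\mathbb{Q}(q^{1/2})[[G_0(\mathcal{T}_n)^+]]$ is the ring of formal power series over $\mathbb{Q}(q^{1/2})$ in the symbols $y^{\underline{\dim}\,M}$, $M\in\mathcal{T}_n$ (i.e. in $y^{d}$, $d\in\mathbb{Z}_{\ge0}^n$), with multiplication determined by $y^{\underline{\dim}\,M}\cdot y^{\underline{\dim}\,N}=q^{\frac12\lambda([M],[N])}\,y^{\underline{\dim}(M\oplus N)}$. Quantum dilogarithm: it is the series $$\mathbb{E}(y)=\sum_{m=0}^{\infty}\frac{q^{m^2/2}}{(q^m-q^{m-1})(q^m-q^{m-2})\cdots(q^m-1)}\,y^m\in\mathbb{Q}(q^{1/2})[[y]],$$ whose $m=0$ term is $1$; $\mathbb{E}(y^{d})$ is obtained by substituting $y^{d}$ for $y$. *)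

(* Defs.v *)
From HB Require Import structures.
From mathcomp Require Import all_boot all_order all_algebra.
From mathcomp Require Import complex.
From mathcomp Require Import reals trigo.

Set Implicit Arguments.
Unset Strict Implicit.
Unset Printing Implicit Defensive.

Import Order.TTheory GRing.Theory Num.Theory.
Local Open Scope ring_scope.
Local Open Scope complex_scope.

(* The vertices 1..n of the cyclic quiver are the elements of 'I_n and [ordS] *)
(* is the cyclic successor.  A representation of the opposite quiver has one  *)
(* map V_(i+1) -> V_i per vertex; vectors are rows, so the map is             *)
(* v |-> v *m mor i and composites are read from left to right.               *)
Record rep (k : fieldType) (n : nat) := Rep {
  dimvec : {ffun 'I_n -> nat};
  mor : forall i : 'I_n, 'M[k]_(dimvec (ordS i), dimvec i)
}.

(* The composite V_(i+m) -> ... -> V_(i+1) -> V_i of m consecutive arrows. *)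
Fixpoint pathmx (k : fieldType) (n : nat) (M : rep k n) (m : nat) (i : 'I_n) :
    'M[k]_(dimvec M (iter m (@ordS n) i), dimvec M i) :=
  if m is m'.+1 then mor M (iter m' (@ordS n) i) *m pathmx M m' i else 1%:M.

Definition nilpotent_rep (k : fieldType) (n : nat) (M : rep k n) : Prop :=
  exists m : nat, forall i : 'I_n, pathmx M m i = 0.

Record nilrep (k : fieldType) (n : nat) := Nilrep {
  rep_of :> rep k n;
  nilrepP : nilpotent_rep rep_of
}.

Section Morphisms.
Variables (k : fieldType) (n : nat).
Implicit Types M N : rep k n.

Definition morphism M N (f : forall i, 'M[k]_(dimvec M i, dimvec N i)) : Prop :=
  forall i, mor M i *m f i = f (ordS i) *m mor N i.

Definition injective_mor M N (f : forall i, 'M[k]_(dimvec M i, dimvec N i)) : Prop :=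
  forall i, row_free (f i).

Definition surjective_mor M N (f : forall i, 'M[k]_(dimvec M i, dimvec N i)) : Prop :=
  forall i, row_full (f i).

Definition iso_rep M N : Prop :=
  exists f : forall i, 'M[k]_(dimvec M i, dimvec N i),
    [/\ morphism f, injective_mor f & surjective_mor f].

Definition proper_subobject M N : Prop :=
  exists f : forall i, 'M[k]_(dimvec M i, dimvec N i),
    [/\ morphism f, injective_mor f & ~ surjective_mor f].

Definition nonzero_rep M : Prop := exists i, dimvec M i <> 0%N.

Definition simple_dim (i : 'I_n) : {ffun 'I_n -> nat} :=
  [ffun j => nat_of_bool (j == i)].

Definition simple_rep (i : 'I_n) : rep k n :=
  @Rep k n (simple_dim i) (fun _ => 0).

End Morphisms.

Section EulerForm.
Variables (k : fieldType) (n : nat).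
Implicit Types M N : rep k n.

(* The vector space of families h of matrices h_i of size a i x b i. *)
Definition mxfam (a b : 'I_n -> nat) :=
  {ffun {i : 'I_n & ('I_(a i) * 'I_(b i))%type} -> k^o}.

Definition fam_get (a b : 'I_n -> nat) (h : mxfam a b) (i : 'I_n) :
    'M[k]_(a i, b i) :=
  \matrix_(r, s) h (Tagged (fun j => ('I_(a j) * 'I_(b j))%type) (r, s)).

Definition fam_of (a b : 'I_n -> nat) (h : forall i, 'M[k]_(a i, b i)) :
    mxfam a b :=
  [ffun u => h (tag u) (tagged u).1 (tagged u).2].

(* An extension 0 -> N -> E -> M -> 0 splits at every vertex, so up to        *)
(* equivalence it is N (+) M with arrows block_mx (mor N i) 0 (c i) (mor M i) *)
(* for a family c; it is a split extension iff c = hom_diff h for some h (see *)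
(* ext_splitP), whence Ext^1(M, N) is the cokernel of hom_diff.  Since M and  *)
(* N nilpotent force E nilpotent, this is also the Ext^1 of the category of   *)
(* nilpotent representations.                                                 *)
Definition hom_diff M N (h : mxfam (dimvec M) (dimvec N)) :
    mxfam (fun i => dimvec M (ordS i)) (dimvec N) :=
  fam_of (fun i => mor M i *m fam_get h i - fam_get h (ordS i) *m mor N i).

Definition homv M N : {vspace mxfam (dimvec M) (dimvec N)} :=
  lker (linfun (@hom_diff M N)).

Definition split_extv M N :
    {vspace mxfam (fun i => dimvec M (ordS i)) (dimvec N)} :=
  limg (linfun (@hom_diff M N)).

Definition dim_hom M N : nat := \dim (homv M N).

Definition dim_ext1 M N : nat :=
  (\dim {:mxfam (fun i => dimvec M (ordS i)) (dimvec N)} - \dim (split_extv M N))%N.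

Definition ext_rep M N (c : mxfam (fun i => dimvec M (ordS i)) (dimvec N)) i :
    'M[k]_(dimvec N (ordS i) + dimvec M (ordS i), dimvec N i + dimvec M i) :=
  block_mx (mor N i) 0 (fam_get c i) (mor M i).

(* G_0 = Z^n, the class of an object being its dimension vector. *)
Definition G0 := {ffun 'I_n -> int}.

Definition class_of (d : {ffun 'I_n -> nat}) : G0 := [ffun i => (d i)%:Z].

(* The bilinear form on G_0 with the prescribed values on the basis [S_i];    *)
(* see eulerE.                                                                *)
Definition euler (x y : G0) : int :=
  \sum_(i < n) \sum_(j < n) x i * y j *
    ((dim_hom (simple_rep k i) (simple_rep k j))%:Z
     - (dim_ext1 (simple_rep k i) (simple_rep k j))%:Z).

Definition lambda (x y : G0) : int := euler x y - euler y x.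

Lemma fam_getK a b (h : forall i, 'M[k]_(a i, b i)) i :
  fam_get (fam_of h) i = h i.
Proof. by apply/matrixP=> r s; rewrite !mxE ffunE. Qed.

Lemma fam_ofK a b (h : mxfam a b) : fam_of (fam_get h) = h.
Proof. by apply/ffunP=> -[i [r s]]; rewrite ffunE mxE. Qed.

Lemma fam_get_linear a b i : linear (@fam_get a b ^~ i).
Proof. by move=> c u v; apply/matrixP=> r s; rewrite !mxE !ffunE. Qed.

Lemma hom_diff_linear M N : linear (@hom_diff M N).
Proof.
move=> c u v; apply/ffunP=> -[i [r s]].
rewrite !ffunE !fam_get_linear /= mulmxDr mulmxDl -scalemxAr -scalemxAl.
by rewrite opprD addrACA -scalerBr !mxE.
Qed.

HB.instance Definition _ M N :=
  GRing.isLinear.Build k (mxfam (dimvec M) (dimvec N))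
    (mxfam (fun i => dimvec M (ordS i)) (dimvec N)) *:%R (@hom_diff M N)
    (@hom_diff_linear M N).

Lemma homvP M N (f : forall i, 'M[k]_(dimvec M i, dimvec N i)) :
  fam_of f \in homv M N <-> morphism f.
Proof.
rewrite memv_ker lfunE /=; split=> [/eqP E i|E].
  move: (congr1 (@fam_get _ _ ^~ i) E); rewrite fam_getK !fam_getK.
  have -> : fam_get (0 : mxfam (fun i => dimvec M (ordS i)) (dimvec N)) i = 0.
    by apply/matrixP=> r s; rewrite !mxE ffunE.
  by move/eqP; rewrite subr_eq0 => /eqP.
apply/eqP/ffunP=> -[i [r s]]; rewrite !ffunE /= !fam_getK E subrr.
by rewrite mxE.
Qed.

(* [row_mx (h i) 1] is the general section M_i -> N_i (+) M_i. *)
Lemma ext_splitP M N (c : mxfam (fun i => dimvec M (ordS i)) (dimvec N)) :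
  c \in split_extv M N <->
  exists h : forall i, 'M[k]_(dimvec M i, dimvec N i),
    forall i, mor M i *m row_mx (h i) 1%:M
              = row_mx (h (ordS i)) 1%:M *m ext_rep c i.
Proof.
split=> [/memv_imgP[h _ ->]|[h E]].
  exists (fam_get h) => i; rewrite lfunE /= /ext_rep fam_getK.
  rewrite mul_mx_row mul_row_block !mul1mx mulmx1 mulmx0 add0r.
  by rewrite addrC subrK.
apply/memv_imgP; exists (fam_of h); first exact: memvf.
rewrite lfunE /= -[c]fam_ofK; apply/ffunP=> -[i [r s]]; rewrite !ffunE /=.
rewrite !fam_getK; move: (E i).
rewrite mul_mx_row mul_row_block !mul1mx mulmx1 mulmx0 add0r.
by case/eq_row_mx=> -> _; rewrite [X in X - _]addrC addrK.
Qed.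

Lemma dim_mxfam a b : \dim {:mxfam a b} = (\sum_(i < n) a i * b i)%N.
Proof.
rewrite dimvf /dim /= muln1 card_tagged sumnE big_map big_enum /=.
by apply: eq_bigr => i _; rewrite card_prod !card_ord.
Qed.

Lemma dim_hom_ext M N :
  (dim_hom M N)%:Z - (dim_ext1 M N)%:Z
  = \sum_(i < n) (dimvec M i)%:Z * (dimvec N i)%:Z
    - \sum_(i < n) (dimvec M (ordS i))%:Z * (dimvec N i)%:Z.
Proof.
have := limg_ker_dim (linfun (@hom_diff M N)) fullv; rewrite capfv.
have := dimvS (subvf (split_extv M N)).
rewrite /dim_hom /dim_ext1 /homv /split_extv => le E.
rewrite -subzn // !dim_mxfam.
rewrite opprB addrA -PoszD E dim_mxfam.
congr (_ - _); rewrite -natz natr_sum; apply: eq_bigr => i _.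
  by rewrite natz PoszM.
by rewrite natz PoszM.
Qed.

Lemma eulerE M N :
  euler (class_of (dimvec M)) (class_of (dimvec N))
  = (dim_hom M N)%:Z - (dim_ext1 M N)%:Z.
Proof.
rewrite dim_hom_ext -sumrB /euler.
under eq_bigr => i _ do under eq_bigr => j _ do
  rewrite dim_hom_ext -sumrB mulr_sumr.
under eq_bigr => i _ do rewrite exchange_big /=.
rewrite exchange_big /=; apply: eq_bigr => l _.
under eq_bigr => i _.
  rewrite (bigD1 l) //= big1 ?addr0; last first.
    by move=> j jl; rewrite !ffunE [l == j]eq_sym (negPf jl) ?(mulr0, subr0).
  rewrite !ffunE eqxx !mulr1.
  over.
rewrite /= (eq_bigr (fun i : 'I_n =>
   (dimvec M i)%:Z * (dimvec N l)%:Z * (l == i)%:Z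
   - (dimvec M i)%:Z * (dimvec N l)%:Z * (ordS l == i)%:Z)); last first.
  by move=> i _; rewrite mulrBr.
rewrite sumrB (bigD1 l) //= eqxx mulr1 big1 ?addr0; last first.
  by move=> i il; rewrite eq_sym (negPf il) mulr0.
rewrite (bigD1 (ordS l)) //= eqxx mulr1 big1 ?addr0 //.
by move=> i il; rewrite eq_sym (negPf il) mulr0.
Qed.

End EulerForm.

Section Stability.
Variables (k : fieldType) (n : nat) (R : realType).
Implicit Types X Y : nilrep k n.

(* The argument in ]-pi, pi]; only its values on nonzero z matter. *)
Definition arg (z : R[i]) : R :=
  let t := acos (complex.Re z / Num.sqrt (complex.Re z ^+ 2 + complex.Im z ^+ 2)) in
  if 0 <= complex.Im z then t else - t.

Definition phase (Z : {additive G0 n -> R[i]}) X : R :=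
  arg (Z (class_of (dimvec X))).

Definition stability_function (Z : {additive G0 n -> R[i]}) : Prop :=
  forall X, nonzero_rep X ->
    Z (class_of (dimvec X)) <> 0 /\ 0 <= phase Z X < pi.

Definition stable (Z : {additive G0 n -> R[i]}) X : Prop :=
  nonzero_rep X /\
  forall Y, nonzero_rep Y -> proper_subobject Y X -> phase Z Y < phase Z X.

Definition semistable (Z : {additive G0 n -> R[i]}) X : Prop :=
  nonzero_rep X /\
  forall Y, nonzero_rep Y -> proper_subobject Y X -> phase Z Y <= phase Z X.

(* The objects of the full subcategory A_mu. *)
Definition in_Amu (Z : {additive G0 n -> R[i]}) (mu : R) X : Prop :=
  ~ nonzero_rep X \/ (semistable Z X /\ phase Z X = mu).

(* A_mu is an abelian subcategory, so its monomorphisms are the injections. *)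
Definition simple_in_Amu (Z : {additive G0 n -> R[i]}) (mu : R) X : Prop :=
  [/\ nonzero_rep X, in_Amu Z mu X &
      forall Y, in_Amu Z mu Y -> nonzero_rep Y -> ~ proper_subobject Y X].

Definition discrete (Z : {additive G0 n -> R[i]}) : Prop :=
  forall mu : R, 0 <= mu < pi ->
    (forall X, in_Amu Z mu X -> ~ nonzero_rep X) \/
    (exists S, simple_in_Amu Z mu S /\
       forall S', simple_in_Amu Z mu S' -> iso_rep S' S).

End Stability.

Section QuantumTorus.
Variables (k : fieldType) (n : nat).

(* Q(q^(1/2)) is the field of rational functions in the variable qhalf. *)
Definition Kq := {fraction {poly rat}}.
Definition qhalf : Kq := tofrac ('X : {poly rat}).
Definition q : Kq := qhalf ^+ 2.

(* Formal power series: f d is the coefficient of y^d. *)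
Definition qtorus := {ffun 'I_n -> nat} -> Kq.

Definition qt_monomial (d : {ffun 'I_n -> nat}) : qtorus :=
  fun e => (e == d)%:R.

Definition qt_one : qtorus := qt_monomial [ffun=> 0%N].

(* The coefficient at e collects the pairs (a, b) with a + b = e, indexed by  *)
(* the a that are bounded by e componentwise.                                 *)
Definition qt_mul (f g : qtorus) : qtorus := fun e =>
  \sum_(u : {dffun forall i : 'I_n, 'I_(e i).+1})
    let a : {ffun 'I_n -> nat} := [ffun i => u i : nat] in
    let b : {ffun 'I_n -> nat} := [ffun i => (e i - u i)%N] in
    qhalf ^ (lambda k (class_of a) (class_of b)) * f a * g b.

Definition qt_exp (f : qtorus) (m : nat) : qtorus := iter m (qt_mul f) qt_one.

Definition dilog_coef (m : nat) : Kq :=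
  qhalf ^+ (m ^ 2) / \prod_(j < m) (q ^+ m - q ^+ j).

(* E(f) = \sum_m dilog_coef m f^m for f without constant term: the terms with *)
(* m > |e| do not contribute to the coefficient at e.                         *)
Definition dilog (f : qtorus) : qtorus := fun e =>
  \sum_(m < (\sum_(i < n) e i).+1) dilog_coef m * qt_exp f m e.

End QuantumTorus.

Section ProductOverStables.
Variables (k : fieldType) (n : nat) (R : realType).

Definition delta : {ffun 'I_n -> nat} := [ffun=> 1%N].

(* L lists the isomorphism classes of stable objects of dimension vector      *)
(* different from delta, each exactly once, in the order of decreasing phase. *)
Definition stable_enumeration (Z : {additive G0 n -> R[i]}) (m : nat)
    (L : 'I_m -> nilrep k n) : Prop :=
  [/\ forall a, stable Z (L a) /\ dimvec (L a) <> delta,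
      forall X : nilrep k n, stable Z X -> dimvec X <> delta ->
        exists! a, iso_rep X (L a) &
      forall a b : 'I_m, (a < b)%N -> phase Z (L b) < phase Z (L a)].

Definition is_EZ (Z : {additive G0 n -> R[i]}) (E : qtorus n) : Prop :=
  exists (m : nat) (L : 'I_m -> nilrep k n),
    stable_enumeration Z L /\
    E = \big[@qt_mul k n/@qt_one n]_(a < m)
          dilog k (qt_monomial (dimvec (L a))).

End ProductOverStables.

(* Main.v *)
Require Import Defs.
From HB Require Import structures.
From mathcomp Require Import all_boot all_order all_algebra.
From mathcomp Require Import complex.
From mathcomp Require Import reals.
From mathcomp Require Import boolp trigo zify ring lra.
Set Implicit Arguments.
Unset Strict Implicit.
Unset Printing Implicit Defensive.
Import Order.TTheory GRing.Theory Num.Theory.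
Local Open Scope ring_scope.
Local Open Scope complex_scope.

(* Write D_i for the automorphism y^d |-> q^(d_i) y^d of the quantum torus and *)
(* V_i for 1 + q^(1/2) * the sum of y^X over the dimension vectors X of the    *)
(* uniserial objects of length < n with top S_i.  Every E_Z solves the system  *)
(* D_i E = V_i E for all i, and a series solving this system is determined by  *)
(* its constant term, because (q^(d_i) - 1) E_d is expressed by coefficients   *)
(* of lower degree.                                                            *)
(*                                                                             *)
(* That E_Z solves the system: by discreteness exactly one vertex c allows the *)
(* cycle to be cut so that all stable objects of dimension vector <> delta     *)
(* live on the resulting interval.  Restrict to coefficients supported on the  *)
(* first vertices after c, adding the vertices one at a time.  For the vertex  *)
(* i added last, D_i E = V_i E follows by moving V_i through the ordered       *)
(* product one dilogarithm at a time: after each step the terms that survive   *)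
(* are the arcs with top i whose Harder-Narasimhan factors have not been       *)
(* passed.  For the other vertices it follows from the flatness relation       *)
(* D_i(V_j) V_i = D_j(V_i) V_j.                                                *)
(*                                                                             *)
(* A stable X has no two nonzero subobjects whose dimension vectors add up to  *)
(* that of X.  Kernel and image of going once round the cycle exclude Loewy    *)
(* length > n; if the Loewy length is at most n, the span of the images of a   *)
(* vector of maximal nilpotency order has a complement, hence is all of X.     *)

(** * The quantum torus as a ring *)

(** The products are compared through a system of q-difference equations that does not mention [Z].
    The dilogarithm satisfies E(qy) = (1 + q^(1/2) y) E(y) ([scaleby_qdilog1]), and moving [topV i]
    through an ordered product by repeated use of this identity gives
    [scaleby (coord i) E = topV i * E] for every vertex ([arc_prod_system]). Solutions with the same
    constant term agree ([scaleby_system_eq0]), whence [EZ_unique].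

    Objects enter only through arcs, written as integer intervals [[a, b)] read modulo [n], with
    socle at [a] and top at [b - 1]. A stable object has the dimension vector of an arc
    ([stable_dimvec]), an arc shorter than [n] that passes the numerical test [stab] is realised by
    a stable object ([arc_rep_stable]), and discreteness makes stable objects of equal phase
    isomorphic ([stable_iso]). The height of Z of [[0, t)] over the line through Z of delta is
    periodic in [t]; cutting the cycle where it is maximal leaves all relevant stable arcs inside
    one window ([exists_cut], [stab_no_crossing]).

    Within a window the equation of the last vertex is obtained by [coverV_cons], one dilogarithm at
    a time. It propagates to the other vertices because the system is flat ([topV_flat]): the defect
    of the [i]-th equation satisfies a homogeneous equation in the direction [j], and it vanishes
    for y_j = 0 by induction ([truncate_coord_swap]). *)

Section QuantumTorusRing.
Variables (k : fieldType) (n : nat).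
Local Notation dims := {ffun 'I_n -> nat}.
Implicit Types a b c d e : dims.

Definition pairing a b : int := lambda k (class_of a) (class_of b).
Definition twist a b : Kq := qhalf ^ pairing a b.

(** The Euler form depends on classes only, so it may be evaluated on representations with zero
    arrows; its diagonal terms are symmetric and cancel. *)
Lemma pairingE a b :
  pairing a b = \sum_(i < n) ((a i)%:Z * (b (ordS i))%:Z
                              - (a (ordS i))%:Z * (b i)%:Z).
Proof.
pose M d := @Rep k n d (fun _ => 0).
rewrite /pairing /lambda (eulerE (M a) (M b)) (eulerE (M b) (M a)).
rewrite !dim_hom_ext /= sumrB.
have -> : \sum_(i < n) (b i)%:Z * (a i)%:Z = \sum_(i < n) (a i)%:Z * (b i)%:Z.
  by apply: eq_bigr => i _; rewrite mulrC.
have -> : \sum_(i < n) (b (ordS i))%:Z * (a i)%:Z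
          = \sum_(i < n) (a i)%:Z * (b (ordS i))%:Z.
  by apply: eq_bigr => i _; rewrite mulrC.
by ring.
Qed.

Lemma pairingDl a b c : pairing (a + b) c = pairing a c + pairing b c.
Proof.
rewrite !pairingE -big_split; apply: eq_bigr => i _ /=; rewrite !ffunE !PoszD.
by ring.
Qed.

Lemma pairingC a b : pairing a b = - pairing b a.
Proof. by rewrite /pairing /lambda opprB. Qed.

Lemma pairingDr a b c : pairing a (b + c) = pairing a b + pairing a c.
Proof. by rewrite pairingC pairingDl opprD -!pairingC. Qed.

Lemma pairing0l a : pairing 0 a = 0.
Proof. by rewrite pairingE big1 // => i _; rewrite !ffunE !mul0r. Qed.

Lemma pairing0r a : pairing a 0 = 0.
Proof. by rewrite pairingC pairing0l oppr0. Qed.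

Lemma pairingMnl a b m : pairing (a *+ m) b = pairing a b *+ m.
Proof.
elim: m => [|m IH]; first by rewrite !mulr0n pairing0l.
by rewrite !mulrS pairingDl IH.
Qed.

Lemma pairing_self a : pairing a a = 0.
Proof. by rewrite /pairing /lambda subrr. Qed.

Lemma qhalf_neq0 : qhalf != 0.
Proof. by rewrite /qhalf tofrac_eq0 polyX_eq0. Qed.

Lemma twistDl a b c : twist (a + b) c = twist a c * twist b c.
Proof. by rewrite /twist pairingDl expfzDr ?qhalf_neq0. Qed.

Lemma twistDr a b c : twist a (b + c) = twist a b * twist a c.
Proof. by rewrite /twist pairingDr expfzDr ?qhalf_neq0. Qed.

Lemma twist0l a : twist 0 a = 1.
Proof. by rewrite /twist pairing0l expr0z. Qed.

Lemma twist0r a : twist a 0 = 1.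
Proof. by rewrite /twist pairing0r expr0z. Qed.

(* Summing over boxes of a fixed size makes the indices of the iterated      *)
(* products independent of each other.                                       *)
Definition box N := {ffun 'I_n -> 'I_N.+1}.
Definition unbox N (u : box N) : dims := [ffun i => u i : nat].
Definition tobox N (a : dims) : box N := [ffun i => inord (a i)].

Lemma unboxK N (u : box N) : tobox N (unbox u) = u.
Proof. by apply/ffunP => i; rewrite !ffunE inord_val. Qed.

Lemma toboxK N a : (forall i, (a i <= N)%N) -> unbox (tobox N a) = a.
Proof. by move=> aN; apply/ffunP => i; rewrite !ffunE inordK ?ltnS. Qed.

Definition dmul (f g : qtorus n) : qtorus n := @qt_mul k n f g.

(** The bound [N] is free, so all coefficients occurring in one computation can be summed over the
    same box. *)
Lemma dmulE N f g e : (forall i, (e i <= N)%N) ->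
  dmul f g e = \sum_(u : box N) \sum_(v : box N | unbox u + unbox v == e)
                 twist (unbox u) (unbox v) * f (unbox u) * g (unbox v).
Proof.
move=> eN.
pose F (u : box N) := \sum_(v : box N | unbox u + unbox v == e)
                 twist (unbox u) (unbox v) * f (unbox u) * g (unbox v).
rewrite -/F.
pose P (u : box N) := [forall i, (u i <= e i)%N].
rewrite (bigID P) /= [X in _ + X]big1 ?addr0; last first.
  move=> u; rewrite negb_forall => /existsP[i nu].
  apply: big_pred0 => v; apply/negbTE; apply: contra nu => /eqP <-.
  by rewrite !ffunE leq_addr.
pose h (u : {dffun forall i : 'I_n, 'I_(e i).+1}) : box N :=
  [ffun i => inord (u i)].
pose h' (u : box N) : {dffun forall i : 'I_n, 'I_(e i).+1} :=
  [ffun i => inord (u i)].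
have hE (u : {dffun forall i : 'I_n, 'I_(e i).+1}) i : h u i = u i :> nat.
  by rewrite ffunE inordK // ltnS; apply: leq_trans (eN i); rewrite -ltnS.
have h'E u i : P u -> h' u i = u i :> nat.
  by move=> /forallP Pu; rewrite ffunE inordK // ltnS.
have Ph u : P (h u) by apply/forallP => i; rewrite hE -ltnS.
rewrite (reindex_onto h h') /=; last first.
  by move=> u Pu; apply/ffunP => i; apply: ord_inj; rewrite hE h'E.
rewrite /dmul /qt_mul; apply: eq_big => [u|u _].
  rewrite Ph; apply/esym/eqP/ffunP => i; apply: ord_inj.
  by rewrite h'E // hE.
have E1 : [ffun i => u i : nat] = unbox (h u).
  by apply/ffunP => i; rewrite [LHS]ffunE [RHS]ffunE hE.
set b : dims := [ffun i => (e i - u i)%N].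
have E2 : unbox (tobox N b) = b.
  by rewrite toboxK // => i; rewrite ffunE; apply: leq_trans (leq_subr _ _) (eN i).
rewrite /F (bigD1 (tobox N b)) /=.
  rewrite big1 ?addr0; first by rewrite E1 E2.
  move=> v /andP[/eqP Ev /eqP nv]; case: nv; rewrite -(unboxK v); congr tobox.
  apply/ffunP => i; have := congr1 (fun d : dims => d i) Ev.
  rewrite [LHS]ffunE [unbox (h u) i]ffunE hE [b i]ffunE => E.
  have {}E : (u i + unbox v i)%N = e i := E.
  by apply/eqP; rewrite -(eqn_add2l (u i)) E subnKC // -ltnS.
rewrite E2; apply/eqP/ffunP => i; rewrite [LHS]ffunE [unbox _ i]ffunE [b i]ffunE.
rewrite [LHS](_ : _ = (h u i + (e i - u i))%N) // hE; apply: subnKC.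
by rewrite -ltnS.
Qed.

Lemma dmulA : associative dmul.
Proof.
move=> f g h; apply: funext => e.
pose N := (\sum_i e i)%N.
have eN i : (e i <= N)%N by rewrite /N (bigD1 i) //= leq_addr.
have leN (a b : dims) : a + b = e -> forall i, (a i <= N)%N /\ (b i <= N)%N.
  by move=> E i; split; apply: leq_trans (eN i); rewrite -E ffunE ?leq_addr ?leq_addl.
(* Both bracketings are brought to this sum over triples; by bilinearity of the pairing, the total
   twist is the product over the three ordered pairs. *)
transitivity (\sum_(u : box N) \sum_(v : box N) \sum_(w : box N | unbox u + unbox v + unbox w == e)
   twist (unbox u) (unbox v) * twist (unbox u) (unbox w) * twist (unbox v) (unbox w)
    * f (unbox u) * g (unbox v) * h (unbox w)).
  rewrite (dmulE _ _ eN); apply: eq_bigr => u _.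
  rewrite [RHS](eq_bigr (fun v : box N => \sum_(w : box N) \sum_(x : box N |
      (unbox v + unbox w == unbox x) && (unbox u + unbox x == e))
    twist (unbox u) (unbox v) * twist (unbox u) (unbox w) * twist (unbox v) (unbox w)
    * f (unbox u) * g (unbox v) * h (unbox w))); last first.
    move=> v _; rewrite big_mkcond; apply: eq_bigr => w _; case: ifP => E.
      have Ex : unbox (tobox N (unbox v + unbox w)) = unbox v + unbox w.
        apply: toboxK => i; have /leN/(_ i)[] // : unbox u + (unbox v + unbox w) = e.
        by rewrite addrA; exact/eqP.
      rewrite (big_pred1 (tobox N (unbox v + unbox w))) // => x.
      apply/andP/eqP => [[/eqP -> _]|->]; first by rewrite unboxK.
      by rewrite Ex addrA E eqxx.
    rewrite big_pred0 // => x; apply/negbTE; rewrite negb_and -implybE.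
    by apply/implyP => /eqP <-; rewrite addrA E.
  rewrite (eq_bigr (fun v : box N => \sum_(x : box N | unbox u + unbox x == e)
     \sum_(w : box N | unbox v + unbox w == unbox x)
    twist (unbox u) (unbox v) * twist (unbox u) (unbox w) * twist (unbox v) (unbox w)
    * f (unbox u) * g (unbox v) * h (unbox w))); last first.
    move=> v _; rewrite (exchange_big_dep (fun x : box N => unbox u + unbox x == e)) /=.
      apply: eq_bigr => x Ex; apply: eq_bigl => w; rewrite Ex andbT //.
    by move=> w x _ /andP[].
  rewrite exchange_big /=; apply: eq_bigr => x /eqP Ex.
  have xN i := (leN _ _ Ex i).2.
  rewrite (dmulE _ _ xN) mulr_sumr; apply: eq_bigr => v _.
  rewrite mulr_sumr; apply: eq_bigr => w /eqP <-.
  by rewrite twistDr; ring.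
rewrite (dmulE _ _ eN).
rewrite (eq_bigr (fun u : box N => \sum_(w : box N) \sum_(v : box N |
    unbox u + unbox v + unbox w == e)
   twist (unbox u) (unbox v) * twist (unbox u) (unbox w) * twist (unbox v) (unbox w)
    * f (unbox u) * g (unbox v) * h (unbox w))); last first.
  move=> u _; rewrite (exchange_big_dep predT) //=.
rewrite exchange_big /= [RHS](exchange_big_dep predT) //=; apply: eq_bigr => w _.
rewrite (eq_bigr (fun u : box N => \sum_(v : box N) \sum_(x : box N |
    (unbox u + unbox v == unbox x) && (unbox x + unbox w == e))
    twist (unbox u) (unbox v) * twist (unbox u) (unbox w) * twist (unbox v) (unbox w)
    * f (unbox u) * g (unbox v) * h (unbox w))); last first.
  move=> u _; rewrite big_mkcond; apply: eq_bigr => v _; case: ifP => E.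
    have Ex : unbox (tobox N (unbox u + unbox v)) = unbox u + unbox v.
      apply: toboxK => i; have /leN/(_ i)[] // : (unbox u + unbox v) + unbox w = e.
      exact/eqP.
    rewrite (big_pred1 (tobox N (unbox u + unbox v))) // => x.
    apply/andP/eqP => [[/eqP -> _]|->]; first by rewrite unboxK.
    by rewrite Ex E eqxx.
  rewrite big_pred0 // => x; apply/negbTE; rewrite negb_and -implybE.
  by apply/implyP => /eqP <-; rewrite E.
rewrite (eq_bigr (fun u : box N => \sum_(x : box N | unbox x + unbox w == e)
     \sum_(v : box N | unbox u + unbox v == unbox x)
    twist (unbox u) (unbox v) * twist (unbox u) (unbox w) * twist (unbox v) (unbox w)
    * f (unbox u) * g (unbox v) * h (unbox w))); last first.
  move=> u _; rewrite (exchange_big_dep (fun x : box N => unbox x + unbox w == e)) /=.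
    by apply: eq_bigr => x Ex; apply: eq_bigl => v; rewrite Ex andbT.
  by move=> v x _ /andP[].
rewrite exchange_big /=; apply: eq_bigr => x /eqP Ex.
have xN i := (leN _ _ Ex i).1.
rewrite (dmulE _ _ xN) mulr_sumr mulr_suml; apply: eq_bigr => u _.
rewrite mulr_sumr mulr_suml; apply: eq_bigr => v /eqP <-.
by rewrite twistDl; ring.
Qed.
End QuantumTorusRing.

(** The product depends on [k] through [lambda] while the carrier does not; the alias records [k],
    so that a ring structure can be attached. *)
Definition qtring (k : fieldType) (n : nat) : Type := qtorus n.

HB.instance Definition _ k n := gen_eqMixin (qtring k n).
HB.instance Definition _ k n := gen_choiceMixin (qtring k n).

Section RingInstances.
Variables (k : fieldType) (n : nat).
Local Notation T := (qtring k n).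
Local Notation dims := {ffun 'I_n -> nat}.
Implicit Types (f g h : T) (c : Kq).

Let zero : T := fun _ => 0.
Let opp f : T := fun e => - f e.
Let add f g : T := fun e => f e + g e.
Let scale c f : T := fun e => c * f e.
Let one : T := @qt_one n.
Let mul f g : T := dmul k f g.

Let addA : associative add.
Proof. by move=> f g h; apply: funext => e; exact: addrA. Qed.
Let addC : commutative add.
Proof. by move=> f g; apply: funext => e; exact: addrC. Qed.
Let add0 : left_id zero add.
Proof. by move=> f; apply: funext => e; exact: add0r. Qed.
Let addN : left_inverse zero opp add.
Proof. by move=> f; apply: funext => e; exact: addNr. Qed.
HB.instance Definition _ := GRing.isZmodule.Build T addA addC add0 addN.

Let leN (e : dims) i : (e i <= \sum_j e j)%N.
Proof. by rewrite (bigD1 i) //= leq_addr. Qed.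

Let mulA : associative mul.
Proof. exact: dmulA. Qed.
Let mul1 : left_id one mul.
Proof.
move=> f; apply: funext => e; rewrite /mul (dmulE _ _ _ (leN e)).
set N := (\sum_j _)%N.
have E0 : unbox (tobox N (0 : dims)) = 0 by apply: toboxK => i; rewrite ffunE.
rewrite (bigD1 (tobox N 0)) //= [X in _ + X]big1 ?addr0; last first.
  move=> u nu; apply: big1 => v _; rewrite /one /qt_one /qt_monomial.
  case: eqP => [E|]; last by rewrite mulr0 mul0r.
  by case/eqP: nu; rewrite -(unboxK u) E.
rewrite (big_pred1 (tobox N e)) => [|v].
  rewrite E0 (toboxK (leN e)) twist0l mul1r /one /qt_one /qt_monomial.
  by case: eqP => [|[]]; rewrite ?mul1r.
rewrite E0 add0r; apply/eqP/eqP => [<-|->]; first by rewrite unboxK.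
exact: toboxK (leN e).
Qed.
Let mulr1 : right_id one mul.
Proof.
move=> f; apply: funext => e; rewrite /mul (dmulE _ _ _ (leN e)).
set N := (\sum_j _)%N.
have E0 : unbox (tobox N (0 : dims)) = 0 by apply: toboxK => i; rewrite ffunE.
rewrite (exchange_big_dep predT) //=.
rewrite (bigD1 (tobox N 0)) //= [X in _ + X]big1 ?addr0; last first.
  move=> u nu; apply: big1 => v _; rewrite /one /qt_one /qt_monomial.
  case: eqP => [E|]; last by rewrite mulr0.
  by case/eqP: nu; rewrite -(unboxK u) E.
rewrite (big_pred1 (tobox N e)) => [|v].
  rewrite E0 (toboxK (leN e)) twist0r mul1r /one /qt_one /qt_monomial.
  by case: eqP => [|[]]; rewrite ?mulr1.
rewrite E0 addr0; apply/eqP/eqP => [<-|->]; first by rewrite unboxK.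
exact: toboxK (leN e).
Qed.
Let mulDl : left_distributive mul add.
Proof.
move=> f g h; apply: funext => e; rewrite /mul /add !(dmulE _ _ _ (leN e)).
rewrite -big_split; apply: eq_bigr => u _ /=; rewrite -big_split.
by apply: eq_bigr => v _ /=; rewrite mulrDr mulrDl.
Qed.
Let mulDr : right_distributive mul add.
Proof.
move=> f g h; apply: funext => e; rewrite /mul /add !(dmulE _ _ _ (leN e)).
rewrite -big_split; apply: eq_bigr => u _ /=; rewrite -big_split.
by apply: eq_bigr => v _ /=; rewrite mulrDr.
Qed.
Let one_neq0 : one != zero.
Proof.
apply/eqP => /(congr1 (fun f => f [ffun=> 0%N])); rewrite /one /qt_one /qt_monomial.
by rewrite eqxx => /eqP; rewrite oner_eq0.
Qed.
HB.instance Definition _ :=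
  GRing.Zmodule_isNzRing.Build T mulA mul1 mulr1 mulDl mulDr one_neq0.

Let scaleA a b f : scale a (scale b f) = scale (a * b) f.
Proof. by apply: funext => e; exact: mulrA. Qed.
Let scale1 : left_id 1 scale.
Proof. by move=> f; apply: funext => e; exact: mul1r. Qed.
Let scaleDr : right_distributive scale +%R.
Proof. by move=> a f g; apply: funext => e; exact: mulrDr. Qed.
Let scaleDl f : {morph scale^~ f : a b / a + b}.
Proof. by move=> a b; apply: funext => e; exact: mulrDl. Qed.
HB.instance Definition _ :=
  GRing.Zmodule_isLmodule.Build Kq T scaleA scale1 scaleDr scaleDl.

Let scaleAl (a : Kq) f g : a *: (f * g) = (a *: f) * g.
Proof.
apply: funext => e; rewrite -[LHS]/(a * dmul k f g e).
rewrite -[RHS]/(dmul k (fun x => a * f x) g e) !(dmulE _ _ _ (leN e)).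
rewrite mulr_sumr; apply: eq_bigr => u _; rewrite mulr_sumr.
by apply: eq_bigr => v _; ring.
Qed.
HB.instance Definition _ := GRing.Lmodule_isLalgebra.Build Kq T scaleAl.

Let scaleAr (a : Kq) f g : a *: (f * g) = f * (a *: g).
Proof.
apply: funext => e; rewrite -[LHS]/(a * dmul k f g e).
rewrite -[RHS]/(dmul k f (fun x => a * g x) e) !(dmulE _ _ _ (leN e)).
rewrite mulr_sumr; apply: eq_bigr => u _; rewrite mulr_sumr.
by apply: eq_bigr => v _; ring.
Qed.
HB.instance Definition _ := GRing.Lalgebra_isAlgebra.Build Kq T scaleAr.

End RingInstances.

(** * Scalings, truncations, and uniqueness of solutions *)

Section TorusTheory.
Variables (k : fieldType) (n : nat).
Local Notation T := (qtring k n).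
Local Notation dims := {ffun 'I_n -> nat}.
Implicit Types (f g h : T) (a b d e : dims).

Lemma addqE f g e : (f + g) e = f e + g e. Proof. by []. Qed.
Lemma oppqE f e : (- f) e = - f e. Proof. by []. Qed.
Lemma subqE f g e : (f - g) e = f e - g e. Proof. by []. Qed.
Lemma scaleqE (c : Kq) f e : (c *: f) e = c * f e. Proof. by []. Qed.
Lemma zeroqE e : (0 : T) e = 0. Proof. by []. Qed.
Lemma sumqE I (r : seq I) (P : pred I) (F : I -> T) e :
  (\sum_(i <- r | P i) F i) e = \sum_(i <- r | P i) F i e.
Proof. by elim/big_rec2: _ => // i x y _ <-. Qed.

Lemma leq_total d i : (d i <= \sum_j d j)%N.
Proof. by rewrite (bigD1 i) //= leq_addr. Qed.

Lemma mulqE f g e : (f * g) e =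
  \sum_(u : box n (\sum_j e j)) \sum_(v : box n (\sum_j e j) | unbox u + unbox v == e)
     twist k (unbox u) (unbox v) * f (unbox u) * g (unbox v).
Proof. exact: dmulE (leq_total e). Qed.

Definition mon d : T := qt_monomial d.

Lemma monE d e : mon d e = (e == d)%:R. Proof. by []. Qed.

Lemma mon0 : mon 0 = 1.
Proof. by apply: funext => e; rewrite monE; congr (_ == _)%:R; apply/ffunP => i;
    rewrite !ffunE. Qed.

Lemma oneqE e : (1 : T) e = (e == 0)%:R.
Proof. by rewrite -mon0. Qed.

Lemma monM a b : mon a * mon b = twist k a b *: mon (a + b).
Proof.
apply: funext => e; rewrite mulqE scaleqE monE.
case: eqP => [->|ne]; last first.
  rewrite mulr0 big1 // => u _; rewrite big1 // => v /eqP E; rewrite !monE.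
  case: eqP => [Eu|]; last by rewrite mulr0 mul0r.
  case: eqP => [Ev|]; last by rewrite mulr0.
  by case: ne; rewrite -E Eu Ev.
rewrite mulr1; set N := (\sum_j _)%N.
have aN : unbox (tobox N a) = a.
  by apply: toboxK => i; apply: leq_trans (leq_total _ i); rewrite ffunE leq_addr.
have bN : unbox (tobox N b) = b.
  by apply: toboxK => i; apply: leq_trans (leq_total _ i); rewrite ffunE leq_addl.
rewrite (bigD1 (tobox N a)) //= [X in _ + X]big1 ?addr0; last first.
  move=> u nu; apply: big1 => v _; rewrite monE.
  case: eqP => [E|]; last by rewrite mulr0 mul0r.
  by case/eqP: nu; rewrite -(unboxK u) E.
rewrite (bigD1 (tobox N b)) ?aN ?bN ?eqxx //= [X in _ + X]big1 ?addr0; last first.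
  move=> u /andP[_ nu]; rewrite [mon b _]monE.
  case: eqP => [E|]; last by rewrite mulr0.
  by case/eqP: nu; rewrite -(unboxK u) E.
by rewrite !monE !eqxx !mulr1.
Qed.

(* For additive phi, the automorphism multiplying y^d by q^(phi d). *)
Definition scaleby (phi : dims -> int) f : T := fun e => q ^ phi e * f e.

Lemma q_neq0 : q != 0.
Proof. by rewrite expf_neq0 ?qhalf_neq0. Qed.

Section Scaleby.
Variable phi : dims -> int.
Hypothesis phiD : {morph phi : a b / a + b >-> a + b}.

Lemma scalebyM f g : scaleby phi (f * g) = scaleby phi f * scaleby phi g.
Proof.
apply: funext => e; rewrite /scaleby !mulqE mulr_sumr; apply: eq_bigr => u _.
rewrite mulr_sumr; apply: eq_bigr => v /eqP E.
have -> : phi e = phi (unbox u) + phi (unbox v) by rewrite -phiD E.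
rewrite expfzDr ?q_neq0 //.
by ring.
Qed.

Lemma scaleby1 : scaleby phi 1 = 1.
Proof.
apply: funext => e; rewrite /scaleby oneqE; case: eqP => [->|]; last by rewrite mulr0.
suff -> : phi 0 = 0 by rewrite expr0z mulr1.
by apply: (@addrI _ (phi 0)); rewrite -phiD !addr0.
Qed.

Lemma scaleby_mon d : scaleby phi (mon d) = q ^ phi d *: mon d.
Proof.
apply: funext => e; rewrite /scaleby scaleqE monE.
by case: eqP => [->|]; rewrite ?mulr0.
Qed.
End Scaleby.

Lemma scalebyD phi f g : scaleby phi (f + g) = scaleby phi f + scaleby phi g.
Proof. by apply: funext => e; rewrite /scaleby !addqE mulrDr. Qed.

Lemma scaleby0 phi : scaleby phi 0 = 0.
Proof. by apply: funext => e; rewrite /scaleby zeroqE mulr0. Qed.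

Lemma scalebyB phi f g : scaleby phi (f - g) = scaleby phi f - scaleby phi g.
Proof. by apply: funext => e; rewrite /scaleby !subqE mulrBr. Qed.

Lemma scalebyZ phi c f : scaleby phi (c *: f) = c *: scaleby phi f.
Proof. by apply: funext => e; rewrite /scaleby !scaleqE mulrCA. Qed.

Lemma scaleby_sum phi I (r : seq I) (P : pred I) (F : I -> T) :
  scaleby phi (\sum_(i <- r | P i) F i) = \sum_(i <- r | P i) scaleby phi (F i).
Proof. by elim/big_rec2: _ => [|i x y _ <-]; rewrite ?scaleby0 // scalebyD. Qed.

Lemma scaleby_comm phi psi f :
  scaleby phi (scaleby psi f) = scaleby psi (scaleby phi f).
Proof. by apply: funext => e; rewrite /scaleby mulrCA. Qed.

Lemma scalebyA phi psi f :
  scaleby phi (scaleby psi f) = scaleby (fun e => phi e + psi e) f.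
Proof. by apply: funext => e; rewrite /scaleby mulrA -expfzDr ?q_neq0. Qed.

Lemma eq_scaleby phi psi f : phi =1 psi -> scaleby phi f = scaleby psi f.
Proof. by move=> E; apply: funext => e; rewrite /scaleby E. Qed.

(** The twists of the two orders are inverse powers of [qhalf], and [q] is its square. *)
Lemma mon_mulC a f : mon a * f = scaleby (pairing k a) f * mon a.
Proof.
apply: funext => e; rewrite !mulqE /scaleby [RHS](exchange_big_dep predT) //=.
apply: eq_bigr => u _; apply: eq_big => [v|v _]; first by rewrite addrC.
rewrite !monE; case: eqP => [->|]; last by rewrite !mulr0 mul0r.
rewrite !mulr1 mulrA; congr (_ * _).
rewrite /twist [pairing k (unbox v) a]pairingC -[q]/(qhalf ^ 2%:Z) exprz_exp.
by rewrite -expfzDr ?qhalf_neq0 //; congr (_ ^ _); ring.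
Qed.

Definition supported (A : {set 'I_n}) d := [forall i, (i \in A) || (d i == 0)%N].

Lemma supportedD A a b : supported A (a + b) = supported A a && supported A b.
Proof.
apply/forallP/andP => [H|[/forallP Ha /forallP Hb] i].
  split; apply/forallP => i; have := H i; rewrite ffunE; case: (i \in A) => //=;
  by rewrite addn_eq0 => /andP[].
have := Ha i; have := Hb i; rewrite ffunE; case: (i \in A) => //= /eqP -> /eqP ->.
by [].
Qed.

(* Setting y_i = 0 for i outside A. *)
Definition truncate A f : T := fun e => if supported A e then f e else 0.

Lemma truncateM A f g : truncate A (f * g) = truncate A f * truncate A g.
Proof.
apply: funext => e; rewrite /truncate !mulqE; case: ifP => Se.
  apply: eq_bigr => u _; apply: eq_bigr => v /eqP E.
  have : supported A (unbox u + unbox v) by rewrite E.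
  by rewrite supportedD => /andP[-> ->].
rewrite big1 // => u _; rewrite big1 // => v /eqP E.
have : ~~ supported A (unbox u + unbox v) by rewrite E Se.
rewrite supportedD negb_and.
by case/orP => /negbTE ->; rewrite ?mulr0 // mul0r.
Qed.

Lemma truncate1 A : truncate A 1 = 1.
Proof.
apply: funext => e; rewrite /truncate oneqE; case: eqP => [->|]; last by rewrite if_same.
by case: ifP => // /forallP[] i; rewrite ffunE eqxx orbT.
Qed.

Lemma truncateD A f g : truncate A (f + g) = truncate A f + truncate A g.
Proof. by apply: funext => e; rewrite /truncate !addqE; case: ifP; rewrite ?addr0. Qed.

Lemma truncate0 A : truncate A 0 = 0.
Proof. by apply: funext => e; rewrite /truncate if_same. Qed.

Lemma truncateB A f g : truncate A (f - g) = truncate A f - truncate A g.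
Proof. by apply: funext => e; rewrite /truncate !subqE; case: ifP; rewrite ?subr0. Qed.

Lemma truncateZ A c f : truncate A (c *: f) = c *: truncate A f.
Proof. by apply: funext => e; rewrite /truncate !scaleqE; case: ifP; rewrite ?mulr0. Qed.

Lemma truncate_sum A I (r : seq I) (P : pred I) (F : I -> T) :
  truncate A (\sum_(i <- r | P i) F i) = \sum_(i <- r | P i) truncate A (F i).
Proof. by elim/big_rec2: _ => [|i x y _ <-]; rewrite ?truncate0 // truncateD. Qed.

Lemma truncate_scaleby A phi f :
  truncate A (scaleby phi f) = scaleby phi (truncate A f).
Proof. by apply: funext => e; rewrite /truncate /scaleby; case: ifP; rewrite ?mulr0. Qed.

Lemma truncate_mon A d : truncate A (mon d) = if supported A d then mon d else 0.
Proof.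
apply: funext => e; rewrite /truncate monE; case: eqP => [->|ne].
  by case: ifP => // _; rewrite monE eqxx.
by rewrite if_same; case: ifP; rewrite ?monE //; case: eqP.
Qed.

Definition coord (i : 'I_n) d : int := (d i)%:Z.

Lemma coordD i : {morph coord i : a b / a + b >-> a + b}.
Proof. by move=> a b; rewrite /coord ffunE PoszD. Qed.

Lemma exprq_neq1 m : (0 < m)%N -> q ^+ m != 1.
Proof.
move=> m0; rewrite -exprM /qhalf -tofracXn -[1]tofrac1 tofrac_eq.
apply/eqP => /(congr1 (fun p : {poly rat} => size p)).
by rewrite size_polyXn size_poly1 => -[]; lia.
Qed.

(** In degree [e] the equation reads [q ^ (e i) * X e = X e] plus products of [U a] and [X b] with
    [a] nonzero, which vanish by hypothesis; and [q ^ (e i)] is not 1. *)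
Lemma coef_rec_eq0 i (U X : T) e :
    U 0 = 1 -> (0 < e i)%N -> scaleby (coord i) X e = (U * X) e ->
    (forall a b, a != 0 -> a + b = e -> X b = 0) ->
  X e = 0.
Proof.
move=> U0 ei; rewrite mulqE; set N := (\sum_j _)%N => + H.
have E0 : unbox (tobox N (0 : dims)) = 0 by apply: toboxK => j; rewrite ffunE.
rewrite (bigD1 (tobox N 0)) //= [X in _ + X]big1 ?addr0; last first.
  move=> u nu; apply: big1 => v /eqP E; rewrite (H _ _ _ E) ?mulr0 //.
  by apply: contra nu => /eqP Eu; rewrite -(unboxK u) Eu.
rewrite (big_pred1 (tobox N e)) => [|v]; last first.
  rewrite E0 add0r; apply/eqP/eqP => [<-|->]; first by rewrite unboxK.
  exact: toboxK (leq_total e).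
rewrite E0 (toboxK (leq_total e)) twist0l U0 !mul1r /scaleby /coord -exprnP.
move/eqP; rewrite -subr_eq0 -{2}[X e]mul1r -mulrBl mulf_eq0 subr_eq0.
by rewrite (negbTE (exprq_neq1 ei)) => /eqP.
Qed.

Lemma dims_lt a b : a != 0 -> (\sum_j b j < \sum_j (a + b)%R j)%N.
Proof.
move=> na; rewrite [X in (_ < X)%N](eq_bigr (fun j => a j + b j)%N); last first.
  by move=> j _; rewrite ffunE.
rewrite big_split /= -{1}[(\sum_j b j)%N]add0n ltn_add2r lt0n sum_nat_eq0.
apply: contra na => /forallP H; apply/eqP/ffunP => j.
by have /eqP := H j; rewrite ffunE.
Qed.

(** Degrees with [e i = 0] are seen by the smaller truncation; the others follow by induction on the
    total degree. *)
Lemma truncate_eq0 A i (U X : T) :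
    U 0 = 1 -> truncate A (scaleby (coord i) X) = truncate A (U * X) ->
    truncate (A :\ i) X = 0 -> 
  truncate A X = 0.
Proof.
move=> U0 HX H0; apply: funext => e.
have [m] := ubnP (\sum_j e j)%N; elim: m e => // m IH e /ltnSE le_em.
rewrite /truncate; case: ifP => // Se.
have [ei|ei] := posnP (e i).
  have := congr1 (fun f : T => f e) H0; rewrite /truncate ifT //.
  apply/forallP => j; rewrite in_setD1; case: (eqVneq j i) => [->|_] /=.
    by rewrite ei.
  exact: (forallP Se j).
have := congr1 (fun f : T => f e) HX; rewrite /truncate Se => E.
apply: coef_rec_eq0 U0 ei E _ => a b na Eab.
have := IH b; rewrite /truncate; move: Se; rewrite -Eab supportedD => /andP[_ ->].
by apply; apply: leq_trans le_em; rewrite -Eab dims_lt.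
Qed.

(** A nonzero degree has some positive coordinate [i], and the [i]-th equation then kills its
    coefficient. Applied to the difference of two solutions, this is uniqueness. *)
Lemma scaleby_system_eq0 (V : 'I_n -> T) (X : T) :
    (forall i, V i 0 = 1) -> (forall i, scaleby (coord i) X = V i * X) ->
    X 0 = 0 ->
  X = 0.
Proof.
move=> V0 HX X0; apply: funext => e.
have [m] := ubnP (\sum_j e j)%N; elim: m e => // m IH e /ltnSE le_em.
have [->|ne] := eqVneq e 0; first exact: X0.
have [i ei] : exists i, (0 < e i)%N.
  apply/existsP; rewrite -[X in is_true X]negbK; apply: contra ne => /existsPn H.
  by apply/eqP/ffunP => i; have := H i; rewrite lt0n negbK ffunE => /eqP.
apply: (coef_rec_eq0 (V0 i) ei); first by rewrite HX.
by move=> a b na E; apply: IH; apply: leq_trans le_em; rewrite -E dims_lt.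
Qed.

End TorusTheory.

(** * The quantum dilogarithm *)

Section Dilogarithm.
Variables (k : fieldType) (n : nat).
Local Notation T := (qtring k n).
Local Notation dims := {ffun 'I_n -> nat}.
Implicit Types (f g h : T) (a b d e : dims).

Lemma addd_inj d : injective (+%R d).
Proof.
move=> a b /ffunP E; apply/ffunP => i; have := E i; rewrite !ffunE => /eqP.
by rewrite eqn_add2l => /eqP.
Qed.

Lemma monME d f e : (mon k d * f) (d + e) = twist k d e * f e.
Proof.
rewrite mulqE; set N := (\sum_j _)%N.
have dN : unbox (tobox N d) = d.
  by apply: toboxK => i; apply: leq_trans (leq_total _ i); rewrite ffunE leq_addr.
have eN : unbox (tobox N e) = e.
  by apply: toboxK => i; apply: leq_trans (leq_total _ i); rewrite ffunE leq_addl.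
rewrite (bigD1 (tobox N d)) //= [X in _ + X]big1 ?addr0; last first.
  move=> u nu; apply: big1 => v _; rewrite monE.
  case: eqP => [E|]; last by rewrite mulr0 mul0r.
  by case/eqP: nu; rewrite -(unboxK u) E.
rewrite (big_pred1 (tobox N e)) => [|v].
  by rewrite dN eN monE eqxx mulr1.
rewrite dN (inj_eq (addd_inj (d := d))); apply/eqP/eqP => [<-|->//]; by rewrite unboxK.
Qed.

Lemma monM_eq0 d f e : (forall e', e <> d + e') -> (mon k d * f) e = 0.
Proof.
move=> H; rewrite mulqE big1 // => u _; rewrite big1 // => v /eqP E.
rewrite monE; case: eqP => [Eu|]; last by rewrite mulr0 mul0r.
by case: (H (unbox v)); rewrite -Eu E.
Qed.

Lemma monX d m : mon k d ^+ m = mon k (d *+ m).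
Proof.
elim: m => [|m IH]; first by rewrite expr0 mulr0n mon0.
rewrite exprS IH monM mulrS /twist pairingC pairingMnl pairing_self mul0rn oppr0.
by rewrite expr0z scale1r.
Qed.

Lemma qt_expE f m : qt_exp k f m = f ^+ m.
Proof. by elim: m => [|m IH] //; rewrite exprS -IH. Qed.

Definition qdilog d : T := dilog k (qt_monomial d).

Lemma mulrn_dims d m i : (d *+ m) i = (d i * m)%N.
Proof. by elim: m => [|m IH]; rewrite ?mulr0n ?muln0 ?ffunE // mulrS ffunE IH mulnS. Qed.

(** The sum may run beyond the total degree of [e]: since [d] is nonzero, [e = d *+ m] forces [m] to
    be at most that degree. *)
Lemma qdilogE d e N : d != 0 -> (\sum_i e i < N)%N ->
  qdilog d e = \sum_(m < N) dilog_coef m * (e == d *+ m)%:R.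
Proof.
move=> nd eN; rewrite /qdilog /dilog.
rewrite (eq_bigr (fun m : 'I__ => dilog_coef m * (e == d *+ m)%:R)); last first.
  by move=> m _; rewrite qt_expE monX.
rewrite (big_ord_widen_cond N predT (fun m : nat => dilog_coef m * (e == d *+ m)%:R)) //=.
rewrite big_mkcond; apply: eq_bigr => m _; case: ifP => // /negbT; rewrite -leqNgt => le.
case: eqP => [E|]; last by rewrite mulr0.
have [i di] : exists i, (0 < d i)%N.
  apply/existsP; rewrite -[X in is_true X]negbK; apply: contra nd => /existsPn H.
  by apply/eqP/ffunP => i; have := H i; rewrite lt0n negbK ffunE => /eqP.
suff le' : (m <= \sum_i e i)%N by have := leq_trans le le'; rewrite ltnn.
rewrite (bigD1 i) //=; apply: leq_trans (leq_addr _ _).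
by rewrite E mulrn_dims leq_pmull.
Qed.

Lemma mulrn_inj d m p : d != 0 -> d *+ m = d *+ p -> m = p.
Proof.
move=> nd E.
have [i di] : exists i, (0 < d i)%N.
  apply/existsP; rewrite -[X in is_true X]negbK; apply: contra nd => /existsPn H.
  by apply/eqP/ffunP => i; have := H i; rewrite lt0n negbK ffunE => /eqP.
have := congr1 (fun x : dims => x i) E; rewrite !mulrn_dims => /eqP.
by rewrite eqn_pmul2l // => /eqP.
Qed.

Lemma qdilog_mulrn d m : d != 0 -> qdilog d (d *+ m) = dilog_coef m.
Proof.
move=> nd; pose N := (maxn (\sum_i (d *+ m)%R i) m).+1.
have mN : (m < N)%N by rewrite ltnS leq_maxr.
rewrite (@qdilogE _ _ N) // ?ltnS ?leq_maxl //.
rewrite (bigD1 (Ordinal mN)) //= eqxx mulr1 big1 ?addr0 // => p np.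
case: eqP => [E|]; last by rewrite mulr0.
by case/eqP: np; apply: val_inj; apply/esym/(mulrn_inj nd E).
Qed.

Lemma qdilog_eq0 d e : d != 0 -> (forall m, e <> d *+ m) -> qdilog d e = 0.
Proof.
move=> nd H; rewrite (qdilogE nd (ltnSn _)) big1 // => m _.
by case: eqP => [/H//|]; rewrite mulr0.
Qed.

Lemma dims_multP d e : (exists m, e = d *+ m) \/ (forall m, e <> d *+ m).
Proof.
case: (pselect (exists m, e = d *+ m)) => [|H]; first by left.
by right => m E; apply: H; exists m.
Qed.

Lemma dilog_coef0 : dilog_coef 0 = 1.
Proof. by rewrite /dilog_coef big_ord0 divr1. Qed.

Let frac_cancel (F : fieldType) (x y z c t : F) : x != 0 -> y != 0 -> z != 0 ->
  x * (t * z * c / (x * (z * y))) = t * (c / y).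
Proof. by move=> x0 y0 z0; field; rewrite x0 y0 z0. Qed.

(** This recursion is the q-difference equation of the dilogarithm read off coefficientwise. *)
Lemma dilog_coefS m : (q ^+ m.+1 - 1) * dilog_coef m.+1 = qhalf * dilog_coef m.
Proof.
have qn1 p : (0 < p)%N -> q ^+ p - 1 != 0 by move=> p0; rewrite subr_eq0 exprq_neq1.
have P0 : \prod_(j < m) (q ^+ m - q ^+ j) != 0.
  apply/prodf_neq0 => j _.
  have -> : q ^+ m - q ^+ j = (q ^+ (m - j) - 1) * q ^+ j.
    by rewrite mulrBl mul1r -exprD subnK // ltnW.
  apply: mulf_neq0; first by apply: qn1; rewrite subn_gt0.
  by rewrite expf_neq0 ?q_neq0.
rewrite /dilog_coef big_ord_recl /= expr0.
rewrite (eq_bigr (fun j : 'I_m => q * (q ^+ m - q ^+ j))); last first.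
  by move=> j _; rewrite /bump /= add1n !exprS mulrBr.
rewrite big_split /= prodr_const card_ord.
have -> : qhalf ^+ (m.+1 ^ 2) = qhalf * q ^+ m * qhalf ^+ (m ^ 2).
  by rewrite -exprM -exprS -exprD; congr (_ ^+ _); lia.
have q0 : q ^+ m != 0 by rewrite expf_neq0 ?q_neq0.
exact: frac_cancel (qn1 m.+1 isT) P0 q0.
Qed.

Section ScalebyDilog.
Variable phi : dims -> int.
Hypothesis phiD : {morph phi : a b / a + b >-> a + b}.

Let phiMn d m : phi (d *+ m) = phi d *+ m.
Proof.
elim: m => [|m IH]; last by rewrite !mulrS phiD IH.
by rewrite !mulr0n; apply: (@addrI _ (phi 0)); rewrite -phiD !addr0.
Qed.

Lemma scaleby_qdilog0 d : d != 0 -> phi d = 0 -> scaleby phi (qdilog d) = qdilog d.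
Proof.
move=> nd p0; apply: funext => e; rewrite /scaleby.
case: (dims_multP d e) => [[m ->]|H]; last by rewrite qdilog_eq0 // mulr0.
by rewrite phiMn p0 mul0rn expr0z mul1r.
Qed.

Lemma scaleby_qdilog1 d : d != 0 -> phi d = 1 ->
  scaleby phi (qdilog d) = (1 + qhalf *: mon k d) * qdilog d.
Proof.
move=> nd p1; rewrite mulrDl mul1r -scalerAl.
apply: funext => e; rewrite /scaleby addqE scaleqE.
case: (dims_multP d e) => [[m ->]|H]; last first.
  rewrite qdilog_eq0 // mulr0 add0r; case: (pselect (exists e', e = d + e')).
    move=> [e' E]; rewrite E monME qdilog_eq0 ?mulr0 // => m E'.
    by apply: (H m.+1); rewrite mulrS E E'.
  by move=> H'; rewrite monM_eq0 ?mulr0 // => e' E; apply: H'; exists e'.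
rewrite phiMn p1 -[1 *+ m]/(m%:R : int) natz -exprnP qdilog_mulrn //.
case: m => [|m].
  rewrite monM_eq0 ?mulr0 ?addr0 ?expr0 ?mul1r // => e'; rewrite mulr0n => E.
  case/eqP: nd; apply/ffunP => i; have := congr1 (fun x : dims => x i) E.
  rewrite !ffunE => /esym/eqP; rewrite addn_eq0 => /andP[/eqP -> _] //.
rewrite mulrS monME qdilog_mulrn // /twist pairingC pairingMnl pairing_self.
rewrite mul0rn oppr0 expr0z mul1r -dilog_coefS.
by ring.
Qed.

End ScalebyDilog.

Lemma qdilog_coef0 d : d != 0 -> qdilog d 0 = 1.
Proof. by move=> nd; rewrite -(mulr0n d) qdilog_mulrn // dilog_coef0. Qed.

Lemma truncate_qdilog A d : d != 0 ->
  truncate A (qdilog d) = if supported A d then qdilog d else 1.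
Proof.
move=> nd.
have SM m : (0 < m)%N -> supported A (d *+ m) = supported A d.
  case: m => // m _; elim: m => // m IH.
  by rewrite mulrS supportedD IH andbb.
have S0 : supported A 0 by apply/forallP => i; rewrite ffunE eqxx orbT.
apply: funext => e; rewrite /truncate.
case: (dims_multP d e) => [[m ->]|H]; last first.
  rewrite qdilog_eq0 // if_same; case: ifP => // _; first by rewrite qdilog_eq0.
  by rewrite oneqE; case: eqP => // /esym E; case: (H 0%N).
case: m => [|m].
  by rewrite mulr0n S0; case: ifP => // _; rewrite qdilog_coef0 // oneqE eqxx.
rewrite SM //; case: ifP => // _; rewrite oneqE; case: eqP => // E.
by have := mulrn_inj nd (etrans E (esym (mulr0n d))).
Qed.

End Dilogarithm.

(** * Arcs on the cycle and the flat system *)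

Section CyclicArcs.
Variables (k : fieldType) (n' : nat).
Local Notation n := n'.+1.
Local Notation T := (qtring k n).
Local Notation dims := {ffun 'I_n -> nat}.
Implicit Types (f g h : T) (d e : dims) (a b j p : nat).

Definition vt j : 'I_n := inZp j.

Lemma vtE j : vt j = (j %% n)%N :> nat. Proof. by []. Qed.

Lemma vt_eq i j : (vt i == vt j) = (i == j %[mod n]).
Proof. by rewrite -val_eqE. Qed.

Lemma vt_addn j : vt (j + n) = vt j.
Proof. by apply/eqP; rewrite vt_eq modnDr. Qed.

Lemma ordS_vt j : ordS (vt j) = vt j.+1.
Proof. by apply: val_inj; rewrite /= -addn1 modnDml addn1. Qed.

Lemma vt_val (i : 'I_n) : vt i = i.
Proof. exact: valZpK. Qed.

Lemma vt_inj_window a i j : (a <= i < a + n)%N -> (a <= j < a + n)%N ->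
  (vt i == vt j) = (i == j).
Proof.
move=> Hi Hj; rewrite vt_eq -(subnK (proj1 (andP Hi))) -(subnK (proj1 (andP Hj))).
by rewrite eqn_modDr !modn_small ?eqn_add2r //; lia.
Qed.

Definition vdim j : dims := [ffun i => nat_of_bool (i == vt j)].
(** The class of the uniserial object with socle at [a] and top at [b - 1]. End points are natural
    numbers rather than vertices, so that an arc may wrap round the cycle. *)
Definition arc a b : dims := \sum_(a <= j < b) vdim j.

Lemma arc_cat a b c : (a <= b <= c)%N -> arc a c = arc a b + arc b c.
Proof. by case/andP=> ab bc; rewrite /arc (big_cat_nat ab bc). Qed.

Lemma arc_nil a : arc a a = 0.
Proof. by rewrite /arc big_geq. Qed.

Lemma arcS a b : (a <= b)%N -> arc a b.+1 = arc a b + vdim b.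
Proof. by move=> ab; rewrite /arc big_nat_recr. Qed.

Lemma arc1 a : arc a a.+1 = vdim a.
Proof. by rewrite arcS // arc_nil add0r. Qed.

Lemma arc_shift a b : arc (a + n) (b + n) = arc a b.
Proof.
rewrite /arc big_addn addnK; apply: eq_bigr => j _.
by apply/ffunP => i; rewrite !ffunE vt_addn.
Qed.

Lemma arc_vt a b x : (a <= x < a + n)%N -> (b <= a + n)%N ->
  arc a b (vt x) = (x < b)%N.
Proof.
move=> /andP[ax xn]; elim: b => [|b IH] bn; first by rewrite /arc big_geq // ffunE.
have [ba|ab] := ltnP b a.
  by rewrite /arc big_geq // ffunE; case: ltnP => //; lia.
rewrite arcS // ffunE IH; last by lia.
rewrite ffunE (@vt_inj_window a) ?ax ?xn //; last by lia.
by rewrite -[GRing.add]/addn; lia.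
Qed.

Lemma pairing_vdim j d :
  pairing k (vdim j) d = (d (vt j.+1))%:Z - (d (vt (j + n')))%:Z.
Proof.
rewrite pairingE sumrB; congr (_ - _).
  rewrite (bigD1 (vt j)) //= big1 ?addr0 => [|i ni].
    by rewrite ffunE eqxx mul1r ordS_vt.
  by rewrite ffunE (negbTE ni) mul0r.
rewrite (bigD1 (vt (j + n'))) //= big1 ?addr0 => [|i ni].
  by rewrite ffunE ordS_vt -addnS vt_addn eqxx mul1r.
rewrite ffunE -(vt_val i) ordS_vt vt_eq; case: eqP => [E|]; last by rewrite mul0r.
case/eqP: ni; rewrite -(vt_val i); apply/eqP; rewrite vt_eq -(eqn_modDr 1).
by rewrite !addn1 E -addnS modnDr.
Qed.

(** The contributions of inner vertices telescope. Successors as end points avoid subtraction in the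
    indices. *)
Lemma pairing_arc a b d : (a <= b)%N ->
  pairing k (arc a.+1 b.+1) d
  = (d (vt b.+1))%:Z + (d (vt b))%:Z - (d (vt a.+1))%:Z - (d (vt a))%:Z.
Proof.
move=> ab; rewrite -(subnK ab); elim: (b - a)%N => [|m IH].
  by rewrite add0n arc_nil pairing0l; ring.
rewrite addSn arcS ?pairingDl ?IH; last by lia.
rewrite pairing_vdim (_ : ((m + a).+1 + n' = (m + a) + n)%N); last by lia.
by rewrite vt_addn; ring.
Qed.

Definition yvar j : T := qhalf *: mon k (vdim j).

Lemma Y_addn j : yvar (j + n) = yvar j.
Proof. by rewrite /yvar /vdim vt_addn. Qed.

(** Factors run from top to socle, which makes concatenation of arcs multiplicative ([w_cat]) with
    no scalar, even beyond a full turn. *)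
Definition arcw a b : T := \prod_(j <- rev (index_iota a b)) yvar j.

Lemma w_nil a : arcw a a = 1.
Proof. by rewrite /arcw /index_iota subnn big_nil. Qed.

Lemma w_cat a b c : (a <= b <= c)%N -> arcw a c = arcw b c * arcw a b.
Proof.
case/andP=> ab bc; rewrite /arcw -big_cat -rev_cat /=; congr (\prod_(j <- rev _) _).
by rewrite /index_iota -{2}(subnKC ab) -iotaD; congr iota; lia.
Qed.

Lemma w1 a : arcw a a.+1 = yvar a.
Proof. by rewrite /arcw /index_iota subSnn /= big_seq1. Qed.

Lemma wS a b : (a <= b)%N -> arcw a b.+1 = yvar b * arcw a b.
Proof. by move=> ab; rewrite (@w_cat a b) ?w1 // ab leqnSn. Qed.

Lemma w_shift a b : arcw (a + n) (b + n) = arcw a b.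
Proof.
have [ab|ba] := leqP a b; last first.
  by rewrite /arcw /index_iota (eqP (ltnW ba)) (_ : (_ - _ = 0)%N) //; lia.
rewrite -(subnK ab); elim: (b - a)%N => [|m IH]; first by rewrite !add0n !w_nil.
rewrite !addSn !wS ?IH ?Y_addn //; lia.
Qed.

Lemma wE a b : (a <= b)%N -> exists c, arcw a b = c *: mon k (arc a b).
Proof.
move=> ab; rewrite -(subnK ab); elim: (b - a)%N => [|m [c E]].
  by exists 1; rewrite !add0n w_nil arc_nil mon0 scale1r.
exists (qhalf * c * twist k (vdim (m + a)) (arc a (m + a))).
rewrite addSn wS ?E /yvar; last by lia.
rewrite -scalerAl -scalerAr scalerA monM scalerA addrC arcS //; lia.
Qed.

(** Each added vertex brings [qhalf] and, against its lower neighbour, a twist inverse to it; so one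
    [qhalf] remains. The bound on the length keeps its upper neighbour off the arc. *)
Lemma w_short a b : (a < b <= a + n')%N -> arcw a b = qhalf *: mon k (arc a b).
Proof.
case/andP=> ab; rewrite -(subnK ab); elim: (b - a.+1)%N => [|m IH] bn.
  by rewrite add0n w1 arc1.
rewrite addSn wS ?IH; [|lia|lia].
rewrite -scalerAl -scalerAr scalerA monM scalerA addrC -arcS; last by lia.
rewrite /twist pairing_vdim arc_vt; [|lia|lia].
rewrite (_ : (m + a.+1 + n' = m + a + n)%N); last by lia.
rewrite vt_addn arc_vt; [|lia|lia].
have -> : ((m + a.+1).+1 < m + a.+1)%N = false by lia.
have -> : (m + a < m + a.+1)%N by lia.
rewrite sub0r exprN1 -mulrA mulfV ?mulr1 //.
exact: qhalf_neq0.
Qed.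

Lemma scaleby_w phi a b : {morph phi : d e / d + e >-> d + e} -> (a <= b)%N ->
  scaleby phi (arcw a b) = q ^ phi (arc a b) *: arcw a b.
Proof.
move=> phiD ab; have [c ->] := wE ab.
by rewrite scalebyZ scaleby_mon !scalerA mulrC.
Qed.

Definition cyclew : T := arcw 0 n.

(** Changing the start moves one factor from one end to the other. It commutes with the rest,
    because the contributions of its two neighbours cancel; for [n' = 0] the rest is empty. *)
Lemma zE a : arcw a (a + n) = cyclew.
Proof.
elim: a => [|a <-] //; rewrite addSn wS; last by lia.
rewrite Y_addn (@w_cat a a.+1) ?w1; last by lia.
have [c ->] : exists c, arcw a.+1 (a + n) = c *: mon k (arc a.+1 (a + n)).
  by apply: wE; lia.
rewrite /yvar -!scalerAl -!scalerAr !monM !scalerA [c * _]mulrC addrC; congr (_ * _ *: _).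
rewrite /twist [pairing k (arc _ _) _]pairingC.
suff -> : pairing k (vdim a) (arc a.+1 (a + n)) = 0 by rewrite oppr0.
rewrite pairing_vdim.
case: (posnP n') => [n0|n0].
  by rewrite (_ : (a + n = a.+1)%N) ?arc_nil ?ffunE //; lia.
rewrite !arc_vt; lia.
Qed.

(** The class delta is in the radical of the antisymmetrised Euler form. *)
Lemma zC f : cyclew * f = f * cyclew.
Proof.
rewrite -(zE 1); have [c ->] : exists c, arcw 1 (1 + n) = c *: mon k (arc 1 n.+1).
  by apply: wE.
rewrite -scalerAl -scalerAr mon_mulC; congr (_ *: (_ * _)).
apply: funext => e; rewrite /scaleby pairing_arc //.
have -> : vt n.+1 = vt 1 := vt_addn 1.
have -> : vt n = vt 0 := vt_addn 0.
by rewrite (_ : _ + _ - _ - _ = 0) ?expr0z ?mul1r //; ring.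
Qed.

(** The arcs with top at [b - 1] and length less than [n], the empty one giving 1. The condition
    [n' <= b] in later lemmas keeps the truncated subtraction exact. *)
Definition arcV b : T := \sum_(b - n' <= a < b.+1) arcw a b.

Lemma V_shift b : (n' <= b)%N -> arcV (b + n) = arcV b.
Proof.
move=> nb; rewrite /arcV (_ : ((b + n).+1 = b.+1 + n)%N) //.
rewrite (_ : (b + n - n' = b - n' + n)%N); last by lia.
rewrite big_addn addnK; apply: eq_bigr => a _; exact: w_shift.
Qed.

(** Putting the vertex [b] on top lengthens every arc by one: the longest closes up to [cyclew], and
    only the empty arc is not reached. *)
Lemma V_rec b : (n' <= b)%N -> yvar b * arcV b = arcV b.+1 - 1 + cyclew.
Proof.
move=> nb; rewrite /arcV big_distrr /=.
rewrite (eq_big_nat _ _ (F2 := fun a => arcw a b.+1)); last by move=> a ?; rewrite wS //; lia.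
rewrite big_ltn; last by lia.
rewrite [in RHS]big_nat_recr /=; last by lia.
rewrite w_nil addrK (_ : (b.+1 - n' = (b - n').+1)%N); last by lia.
rewrite -(zE (b - n')) addrC; congr (_ + arcw _ _); lia.
Qed.

Local Notation D j := (scaleby (coord (vt j))).

Lemma Y_comm j f : yvar j * D (j + n') f = D j.+1 f * yvar j.
Proof.
rewrite /yvar -scalerAl -scalerAr mon_mulC scalebyA; congr (_ *: (_ * _)).
by apply: eq_scaleby => e; rewrite pairing_vdim /coord subrK.
Qed.

Lemma D_w a b j : (a <= j < a + n)%N -> (a <= b <= a + n)%N ->
  D j (arcw a b) = q ^+ (j < b)%N *: arcw a b.
Proof.
move=> ja /andP[ab bn]; rewrite scaleby_w ?/coord ?arc_vt //; exact: coordD.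
Qed.

Lemma D_z j : D j cyclew = q *: cyclew.
Proof.
rewrite -(zE j) D_w ?expr1 //; last by lia.
  by rewrite (_ : (j < j + n)%N) //; lia.
by lia.
Qed.

Lemma D_Y j p : (p < j < p + n)%N -> D p (yvar j) = yvar j.
Proof.
move=> pj; rewrite -w1 -(vt_addn p) D_w; [|lia|lia].
by rewrite (_ : (p + n < j.+1)%N = false) ?expr0 ?scale1r //; lia.
Qed.

(* Concatenation turns the product into the sum of the arcs from s - n' .. s  *)
(* to P; those of length at least n are one turn longer than a short arc.     *)
Lemma w_mul_V P s : (n <= s)%N -> (P < s + n <= P + n')%N ->
  arcw s P * arcV s = \sum_(s.+1 <= a < P.+1) arcw a P * cyclew +
      \sum_(P - n' <= a < s.+1) arcw a P.
Proof.
move=> ns sP; rewrite /arcV big_distrr /=.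
rewrite (eq_big_nat _ _ (F2 := fun a => arcw a P)); last first.
  by move=> a ?; rewrite -w_cat //; lia.
rewrite (@big_cat_nat _ _ _ (P - n')) /=; [|lia|lia].
congr (_ + _); rewrite (_ : (s.+1 = s - n' + n)%N); last by lia.
rewrite (_ : (P.+1 = P - n' + n)%N); last by lia.
rewrite big_addn addnK big_nat [RHS]big_nat; apply: eq_bigr => a ?.
by rewrite -(zE a) -w_cat //; lia.
Qed.

Lemma D_V P s : (n' <= P)%N -> (P <= s + n <= P + n')%N ->
  D s (arcV P) = \sum_(s.+1 <= a < P.+1) arcw a P
              + q *: \sum_(P - n' <= a < s.+1) arcw a P.
Proof.
move=> nP sP; rewrite scaleby_sum (@big_cat_nat _ _ _ s.+1) /=; [|lia|lia].
rewrite addrC; congr (_ + _).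
  rewrite big_nat [RHS]big_nat; apply: eq_bigr => a ?.
  rewrite -(vt_addn s) D_w; [|lia|lia].
  by rewrite (_ : (s + n < P)%N = false) ?expr0 ?scale1r //; lia.
rewrite scaler_sumr big_nat [RHS]big_nat; apply: eq_bigr => a ?.
rewrite D_w; [|lia|lia].
have -> : (s < P)%N by lia.
by rewrite expr1.
Qed.

Let id1 (K : comNzRingType) (q x y t : K) :
  x + q * (y + t) = x + t + q * y + (q - 1) * t.
Proof. by ring. Qed.

Let id2 (K : comNzRingType) (q az a b t bz tz : K) :
  (q - 1) * (az + (b + t)) + (- (a + q * (b + t)) + (az + (q * (bz + tz) +
    (a + (t + (b - q * (az + (tz + bz)))))))) = 0.
Proof. by ring. Qed.

(* The two sums have tops p and p + r; the induction on r starts from the     *)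
(* trivial relation r = 0.                                                    *)
Lemma V_flat p r : (n <= p)%N -> (r < n)%N ->
  D p (arcV (p + r).+1) * arcV p.+1 = D (p + r) (arcV p.+1) * arcV (p + r).+1.
Proof.
move=> np; elim: r => [|r IH] rn; first by rewrite addn0.
have {}IH := IH (ltnW rn).
rewrite (addnS p r); have [j Ej] : {j | j = (p + r)%N} by exists (p + r)%N.
rewrite -Ej in IH *; have [s Es] : {s | s = j.+2} by exists j.+2.
(* One turn later than [p.+1], so that arcs ending at [P] can start at or before [s]. *)
have [P EP] : {P | P = (p.+1 + n)%N} by exists (p.+1 + n)%N.
have nj : (n' <= j.+1)%N by lia.
have ns : (n <= s)%N by lia.
have nP : (n' <= P)%N by lia.
have sP : (P <= s + n <= P + n')%N by lia.
have sP' : (P < s + n <= P + n')%N by lia.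
have jP : (P <= j.+1 + n <= P + n')%N by lia.
have Ps : (P - n' <= s)%N by lia.
have sP1 : (s < P.+1)%N by lia.
have Es' : j.+2 = s by [].
have UE : arcV p.+1 = arcV P by rewrite EP V_shift //; lia.
have VsE : arcV s = yvar j.+1 * arcV j.+1 + 1 - cyclew.
  by rewrite (V_rec nj) [X in X - cyclew]addrAC subrK addrK Es'.
have DYp : D p (yvar j.+1) = yvar j.+1 by apply: D_Y; lia.
have DpV : D p (arcV s) = yvar j.+1 * D p (arcV j.+1) + 1 - q *: cyclew.
  rewrite VsE scalebyB scalebyD (scaleby1 _ (coordD _)) (scalebyM (coordD _)).
  by rewrite D_z DYp.
pose A := \sum_(s.+1 <= a < P.+1) arcw a P.
pose B := \sum_(P - n' <= a < s) arcw a P.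
have DsU : D s (arcV P) = A + q *: (B + arcw s P).
  by rewrite (D_V nP sP) (big_nat_recr _ _ _ Ps).
have DsU' : D j.+1 (arcV P) = A + arcw s P + q *: B.
  by rewrite (D_V nP jP) Es' (big_ltn sP1) [arcw s P + _]addrC.
have UAB : arcV P = A + arcw s P + B.
  rewrite /arcV (big_cat_nat Ps (ltnW sP1)) (big_ltn sP1) /=.
  by rewrite addrC -/A -/B [arcw s P + A]addrC.
have wV : arcw s P * arcV s = A * cyclew + (B + arcw s P).
  by rewrite (w_mul_V ns sP') (big_nat_recr _ _ _ Ps) mulr_suml.
have comm : yvar j.+1 * D j (arcV P) = D s (arcV P) * yvar j.+1.
  by rewrite -Es' -Y_comm addSnnS vt_addn.
rewrite Es' DpV UE mulrBl mulrDl mul1r -mulrA -UE IH UE mulrA comm -mulrA (V_rec nj).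
rewrite Es' mulrDr mulrBr mulr1 -scalerAl zC.
(* The two scalings of [arcV P] differ only on the arc starting at [s], which contains [s] but not
   [j.+1]; [w_mul_V] expands its product with [arcV s]. *)
have -> : D s (arcV P) * arcV s = D j.+1 (arcV P) * arcV s + (q - 1) *: (A * cyclew +
    (B + arcw s P)).
  rewrite -wV DsU DsU' scalerAl -mulrDl; congr (_ * _).
  apply: funext => e; rewrite !(addqE, scaleqE).
  by move: (A e) (B e) (arcw s P e) => x y t; exact: id1.
rewrite DsU UAB !mulrDl -scalerAl mulrDl -!addrA -[RHS]addr0; congr (_ + _).
apply: funext => e; rewrite !(addqE, scaleqE, oppqE, zeroqE).
by move: ((A * cyclew) e) => ?; exact: id2.
Qed.

Lemma V_coef0 b : (n' <= b)%N -> arcV b 0 = 1.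
Proof.
move=> nb; rewrite /arcV big_nat_recr /=; last by lia.
rewrite w_nil addqE oneqE eqxx sumqE big_nat big1 ?add0r // => a ab.
rewrite w_short ?scaleqE ?monE; last by lia.
case: eqP => [E|]; last by rewrite mulr0.
have := congr1 (fun d : dims => d (vt a)) E; rewrite arc_vt ?ffunE; [|lia|lia].
by rewrite (_ : (a < b)%N) //; lia.
Qed.

(* The arcs of length less than n with top vertex i. *)
Definition topV (i : 'I_n) : T := arcV (i + n).+1.

Lemma topV_vt j : (n <= j)%N -> topV (vt j) = arcV j.+1.
Proof.
move=> nj; rewrite /topV vtE; have := divn_eq j n.
have : (0 < j %/ n)%N by rewrite divn_gt0.
move: (j %/ n)%N (j %% n)%N => [//|r] i _ ->; elim: r => [|r IH]; first by rewrite mul1n addnC.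
rewrite IH (_ : ((r.+2 * n + i).+1 = (r.+1 * n + i).+1 + n)%N); last by lia.
rewrite V_shift //; lia.
Qed.

Lemma topV_coef0 i : topV i 0 = 1.
Proof. by apply: V_coef0; lia. Qed.

Lemma topV_flat (i j : 'I_n) :
  scaleby (coord i) (topV j) * topV i = scaleby (coord j) (topV i) * topV j.
Proof.
have flat (x y : 'I_n) : (x <= y)%N ->
    scaleby (coord x) (topV y) * topV x = scaleby (coord y) (topV x) * topV y.
  move=> xy; have rn : (y - x < n)%N by have := ltn_ord y; lia.
  have np : (n <= x + n)%N by lia.
  have := V_flat np rn; rewrite (_ : (x + n + (y - x) = y + n)%N); last by lia.
  by rewrite !vt_addn !vt_val.
by case: (leqP i j) => [/flat//|/ltnW/flat].
Qed.

End CyclicArcs.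

(** * Stable arcs and the ordered product *)

Section StableArcs.
Variables (n' : nat) (disp : Order.disp_t) (R : orderType disp).
Local Notation n := n'.+1.
Variable ph : nat -> nat -> R.
Implicit Types (a b c m s t u : nat).

Local Open Scope order_scope.

(** The see-saw property of phases in the exact sequence with subobject [[a, b)], middle term
    [[a, c)] and quotient [[b, c)]. *)
Definition seesaw := forall a b c, (a < b < c)%N ->
  [/\ ph a b < ph b c -> ph a b < ph a c < ph b c,
      ph b c < ph a b -> ph b c < ph a c < ph a b
    & ph a b = ph b c -> ph a c = ph a b].

(** Stability of the arc [[a, b)]: the subobjects of a uniserial object are its initial arcs. *)
Definition stab a b := (a < b)%N && all (fun t => ph a t < ph a b) (index_iota a.+1 b).

Lemma stabP a b : reflect ((a < b)%N /\ forall t, (a < t < b)%N -> ph a t < ph a b) (stab a b).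
Proof.
apply: (iffP andP) => [] [ab H]; split=> //.
  by move=> t Ht; apply: (allP H); rewrite mem_index_iota.
by apply/allP => t; rewrite mem_index_iota; exact: H.
Qed.

Lemma stabS a : stab a a.+1.
Proof. by apply/stabP; split=> // t; lia. Qed.

(** An arc that is not stable has a shorter initial arc of at least the same phase; descend. *)
Lemma max_stab a b : (a < b)%N -> exists t, [/\ (a < t <= b)%N, stab a t & ph a b <= ph a t].
Proof.
have [m] := ubnP b; elim: m b => // m IH b bm ab.
have [st|nst] := boolP (stab a b); first by exists b; rewrite ab leqnn.
move: nst; rewrite /stab ab /= => /allPn[t]; rewrite mem_index_iota => tab.
rewrite -leNgt => le.
have [||t' [Ht' st le']] := IH t; try lia.
by exists t'; split=> //; [lia|exact: le_trans le'].
Qed.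

Hypothesis ph_seesaw : seesaw.

Lemma seesaw_quot a b c : (a < b < c)%N -> (ph a c < ph b c) = (ph a b < ph a c).
Proof.
move=> /ph_seesaw[H1 H2 H3].
case: (ltgtP (ph a b) (ph b c)) => [/H1/andP[-> ->]|/H2/andP[h h']|E] //.
  by rewrite ltNge (ltW h) ltNge (ltW h').
by rewrite H3 // E ltxx.
Qed.

Lemma seesaw_sub a b c : (a < b < c)%N -> (ph a b < ph b c) = (ph a b < ph a c).
Proof.
move=> /ph_seesaw[H1 H2 H3].
case: (ltgtP (ph a b) (ph b c)) => [/H1/andP[->]|/H2/andP[h h']|E] //.
  by rewrite ltNge (ltW h').
by rewrite H3 // E ltxx.
Qed.

Lemma seesaw_subr a b c : (a < b < c)%N -> (ph b c < ph a b) = (ph a c < ph a b).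
Proof.
move=> /ph_seesaw[H1 H2 H3].
case: (ltgtP (ph a b) (ph b c)) => [/H1/andP[h h']|/H2/andP[h h']|E] //.
  by rewrite ltNge (ltW h).
by rewrite H3 // E ltxx.
Qed.

Variables (c : nat) (Ls : seq (nat * nat)).
Hypothesis cut : forall t, (c < t < c + n)%N -> ph c t < ph c (c + n).
Hypothesis LsE : forall s t,
  ((s, t) \in Ls) = [&& (c <= s)%N, (t <= c + n)%N, stab s t & (s, t) != (c, c + n)%N].

Section Peeling.
Variable m : nat.
Hypothesis cm : (c < m <= c + n)%N.

(** With [l] the factors still to be passed, no stable initial arc of [[u, m)] has been passed yet;
    such arcs [[u, m)] index the surviving terms. *)
Definition covered (l : seq (nat * nat)) u :=
  all (fun t => stab u t ==> ((u, t) \in l)) (index_iota u.+1 m.+1).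

Lemma coveredP l u :
  reflect (forall t, (u < t <= m)%N -> stab u t -> (u, t) \in l) (covered l u).
Proof.
apply: (iffP allP) => H t; first by move=> tm; apply/implyP/H; rewrite mem_index_iota.
by rewrite mem_index_iota => tm; apply/implyP/H.
Qed.

Definition admissible u := (c <= u < m)%N && ~~ ((u == c) && (m == c + n)%N).

Definition lower_part (l : seq (nat * nat)) :=
  forall x, x \in Ls -> (x.2 <= m)%N ->
    x \in l \/ forall y, y \in l -> ph y.1 y.2 < ph x.1 x.2.

Variables (s t : nat) (l : seq (nat * nat)).
Hypothesis Hl : lower_part ((s, t) :: l).
Hypothesis sub : {subset (s, t) :: l <= Ls}.
Hypothesis subm : forall x, x \in (s, t) :: l -> (x.2 <= m)%N.
Hypothesis srt : forall y, y \in l -> ph y.1 y.2 < ph s t.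

Let st_stab : [/\ (c <= s < t)%N, (t <= m)%N, stab s t & (s, t) <> (c, c + n)%N].
Proof.
have := sub (mem_head _ _); rewrite LsE => /and4P[-> _ st /eqP nst].
by split=> //; [case/stabP: st|exact: subm (mem_head _ _)].
Qed.

(** If [u] lay in [[s, t)], the quotient [[u, t)] of a stable arc would have phase at least that of
    [[s, t)], and so would some stable initial arc at [u]; but all of these lie in [l], below
    [[s, t)]. *)
Lemma covered_disjoint u : covered l u -> (u < m)%N -> ~~ (s <= u < t)%N.
Proof.
move=> /coveredP Hu um; apply/negP => /andP[su ut].
have [/andP[cs _] tm /stabP[st H] _] := st_stab.
have [t' [ut' st' le]] := max_stab ut.
have /srt /= lt : (u, t') \in l by apply: Hu st'; lia.
have {le}lt := le_lt_trans le lt.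
move: su; rewrite leq_eqVlt => /orP[/eqP E|su]; first by rewrite E ltxx in lt.
have sut : (s < u < t)%N by rewrite su.
by move: (H u sut); rewrite -seesaw_quot // ltNge (ltW lt).
Qed.

(** By the cut, [[u, c + n)] has larger phase than the full turn, which has larger phase than
    [[c, t)]; being covered says the opposite. *)
Lemma covered_below u : covered l u -> s = c -> m = (c + n)%N -> (u < m)%N ->
  ~~ (s <= u)%N.
Proof.
move=> Hu sc mc um; apply/negP => su.
have := covered_disjoint Hu um; rewrite su /= -leqNgt => tu.
have [/andP[cs st] tm _ ne] := st_stab.
have [t' [ut' st' le]] := max_stab um.
have /srt /= lt : (u, t') \in l by apply: (coveredP _ _ Hu) st'; lia.
have {le}lt := le_lt_trans le lt.
have h1 : ph c u < ph c (c + n) by apply: cut; lia.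
have h2 : ph c t < ph c (c + n) by apply: cut; lia.
move: h1; rewrite -seesaw_quot; last by lia.
move=> h1; have := lt_trans h2 (lt_trans h1 _); rewrite -mc => /(_ _ lt).
by rewrite sc ltxx.
Qed.

(** Only the extension [[s, m)] of [[t, m)] by [[s, t)] is new. If [[t, m)] had a stable initial arc
    outside [l], its phase would exceed that of [[s, t)], and by the see-saw rule some longer stable
    arc starting at [s] would already have been passed. *)
Lemma covered_cons u : admissible u ->
  covered ((s, t) :: l) u = covered l u || ((u == s) && ((t == m) || covered l t)).
Proof.
case/andP=> /andP[cu um] ok.
have [/andP[cs st] tm sst ne] := st_stab; have /stabP[_ sH] := sst.
apply/idP/orP => [Hu|[/coveredP Hu|/andP[/eqP us Ht]]].
- have [Hl'|nc] := boolP (covered l u); [by left|right].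
  case/allPn: nc => t'; rewrite mem_index_iota negb_imply => ut' /andP[st' nl].
  have := coveredP _ _ Hu t'; rewrite in_cons (negbTE nl) orbF => /(_ ut' st') /eqP[Eu Et].
  rewrite Eu eqxx /=; case: (eqVneq t m) => [//|tnm] /=.
  apply/coveredP => t1 t1m st1.
  have inL : (t, t1) \in Ls by rewrite LsE st1 xpair_eqE; lia.
  have [] := Hl inL; first by rewrite /=; lia.
    by rewrite in_cons xpair_eqE => /orP[/andP[/eqP E]|//]; lia.
  move=> /(_ (s, t) (mem_head _ _)) /=; rewrite seesaw_sub; last by lia.
  move=> lt; have [|t2 [st2m st2 le2]] := @max_stab s t1; first by lia.
  have {le2}lt := lt_le_trans lt le2.
  have := coveredP _ _ Hu t2; rewrite Eu => /(_ _ st2); rewrite in_cons.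
  case/(_ _)/orP; first by lia.
    by move=> /eqP[E]; rewrite E ltxx in lt.
  by move=> /srt /= lt'; have := lt_trans lt lt'; rewrite ltxx.
- by apply/coveredP => t' h h'; rewrite in_cons Hu ?orbT.
- apply/coveredP => t1; rewrite us => t1m st1.
  have inL : (s, t1) \in Ls by rewrite LsE st1 xpair_eqE; lia.
  have t1m' : ((s, t1).2 <= m)%N by rewrite /=; lia.
  have [h|] := Hl inL t1m'; first exact: h.
  move=> /(_ (s, t) (mem_head _ _)) /=.
  case: (ltngtP t1 t) => [t1t|tt1|->]; last by rewrite ltxx.
    by rewrite ltNge ltW //; apply: sH; lia.
  have {}Ht : covered l t by case/orP: Ht => // /eqP; lia.
  have [t2 [t2m st2 le2]] := max_stab tt1.
  have /srt /= lt : (t, t2) \in l by apply: (coveredP _ _ Ht) st2; lia.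
  have {le2}lt := le_lt_trans le2 lt.
  move: lt; rewrite seesaw_subr; last by lia.
  by move=> lt lt'; have := lt_trans lt lt'; rewrite ltxx.
Qed.
End Peeling.
End StableArcs.

(** * Exchanging one dilogarithm with one arc *)

Section Peel.
Variables (k : fieldType) (n' : nat).
Local Notation n := n'.+1.
Local Notation T := (qtring k n).
Local Notation dims := {ffun 'I_n -> nat}.
Local Notation D j := (scaleby (coord (vt n' j))).
Local Notation W := (@arcw k n').

Lemma mulw a b (f : T) : (a <= b)%N ->
  f * W a b = W a b * scaleby (fun e => - pairing k (arc n' a b) e) f.
Proof.
move=> ab; have [x ->] := wE k n' ab; rewrite -scalerAl -scalerAr; congr (_ *: _).
rewrite mon_mulC scalebyA; congr (_ * _); apply: funext => e.
by rewrite /scaleby subrr expr0z mul1r.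
Qed.

Lemma arc_neq0 s t : (s < t <= s + n)%N -> arc n' s t != 0.
Proof.
move=> st; apply/eqP => /(congr1 (fun d : dims => d (vt n' s))).
rewrite arc_vt ?ffunE; [|lia|lia].
by rewrite (_ : (s < t)%N) //; lia.
Qed.

(** Two such arcs interact only through a common top or when [[u, m)] sits directly above [[s, t)].
    The excluded cases are those where ends meet across the cut, [c + n] being the vertex [c]
    again. *)
Lemma pairing_window c u s t m :
    (0 < c)%N -> (c <= u < m)%N -> (m <= c + n)%N -> (c <= s < t)%N -> (t <= m)%N ->
    ~ (s = c /\ m = (c + n)%N) -> ~ (u = c /\ m = (c + n)%N) ->
    (u < s)%N || (t <= u)%N ->
  pairing k (arc n' u m) (arc n' s t)
  = ((u < s) && (t == m))%N%:Z - (u == t)%N%:Z.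
Proof.
move=> c0 um mc st tm sm umc us.
case: u um umc us => [|u]; first by lia.
case: m mc tm sm => [|m]; first by lia.
move=> mc tm sm um umc us.
rewrite pairing_arc; last by lia.
have sts : (t <= s + n)%N by lia.

have -> : arc n' s t (vt n' m.+1) = 0%N by rewrite arc_vt; lia.
have -> : arc n' s t (vt n' m) = (t == m.+1)%N by rewrite arc_vt; lia.
have [us'|su] := ltnP u.+1 s.
  rewrite -(vt_addn n' u.+1) -(vt_addn n' u).
  have -> : arc n' s t (vt n' (u.+1 + n)) = 0%N by rewrite arc_vt; lia.
  have -> : arc n' s t (vt n' (u + n)) = 0%N by rewrite arc_vt; lia.
  lia.
have -> : arc n' s t (vt n' u.+1) = 0%N by rewrite arc_vt; lia.
have -> : arc n' s t (vt n' u) = (u.+1 == t)%N by rewrite arc_vt; lia.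
lia.
Qed.

Section PeelStep.
Variables (c m s t : nat).
Hypotheses (c0 : (0 < c)%N) (cm : (m <= c + n)%N) (st : (c <= s < t)%N) (tm : (t <= m)%N).
Hypothesis stn : (s, t) <> (c, (c + n)%N).
Let L := arc n' s t.
Let E : T := qdilog k L.

Let stl : (s < t <= s + n')%N.
Proof.
suff : ~ ((s = c) /\ (t = (c + n)%N)) by lia.
by case=> ? ?; apply: stn; congr (_, _).
Qed.

Let L0 : L != 0. Proof. by apply: arc_neq0; lia. Qed.

Let pairD X : {morph (fun e : dims => - pairing k X e) : d e / d + e >-> d + e}.
Proof. by move=> d e /=; rewrite pairingDr opprD. Qed.

(** Pairing 0 makes the factors commute. For [u = t] the pairing is -1, and the q-difference
    equation yields the extra term [W t m * W s t], which is [W s m]. *)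
Lemma qdilog_w u : (c <= u < m)%N -> (u < s)%N || (t <= u)%N -> (t < m)%N ->
    ~ (s = c /\ m = (c + n)%N) -> ~ (u = c /\ m = (c + n)%N) ->
  E * W u m = (W u m + (if u == t then W s m else 0)) * E.
Proof.
move=> um us tm' h1 h2; rewrite mulw; last by lia.
have p := pairing_window c0 um cm st tm h1 h2 us.
have E0 : (t == m) = false by lia.
rewrite E0 andbF sub0r in p; case: eqVneq p => [->|_] p.
  rewrite /E scaleby_qdilog1 //; last by rewrite -/L p.
  rewrite -w_short // mulrA mulrDr mulr1 -w_cat //; lia.
by rewrite scaleby_qdilog0 ?p ?oppr0 // addr0.
Qed.

(** Both arcs have top [m - 1]: the power of [q] from the scaling cancels the one from the
    exchange. *)
Lemma D_qdilog_w u : (c <= u < m)%N -> (u < s)%N -> t = m ->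
    ~ (u = c /\ m = (c + n)%N) ->
  D m.-1 E * W u m = W u m * E.
Proof.
move=> um us tm' h2; rewrite mulw; last by lia.
have h1 : ~ (s = c /\ m = (c + n)%N) by lia.
have p := pairing_window c0 um cm st tm h1 h2 (introT orP (or_introl us)).
rewrite us tm' eqxx /= (_ : (u == m) = false) ?subr0 in p; last by lia.
rewrite scalebyA scaleby_qdilog0 //.
  by move=> d e; rewrite pairingDr coordD opprD addrACA.
rewrite -/L /coord arc_vt; [|lia|lia].
by move: p; rewrite -tm' -/L => ->; rewrite (_ : (t.-1 < t)%N) //; lia.
Qed.

Lemma D_qdilog_lt : (t < m)%N -> D m.-1 E = E.
Proof.
move=> tm'; rewrite scaleby_qdilog0 //; first exact: coordD.
rewrite -/L /coord; have [h|h] := leqP (s + n) m.-1.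
  by lia.
by rewrite arc_vt; lia.
Qed.

Lemma D_qdilog_eq : t = m -> D m.-1 E = (1 + W s t) * E.
Proof.
move=> tm'; rewrite scaleby_qdilog1 // ?w_short //; first exact: coordD.
by rewrite -/L /coord arc_vt; lia.
Qed.

End PeelStep.

Lemma sum_or_eq (a b s : nat) (P : pred nat) (h : bool) (F : nat -> T) :
  (h -> a <= s < b)%N -> ~~ P s || ~~ h ->
  \sum_(a <= u < b | P u || ((u == s) && h)) F u
  = \sum_(a <= u < b | P u) F u + (if h then F s else 0).
Proof.
case: h => [/(_ isT) sb|_ _]; last first.
  by rewrite addr0; apply: eq_bigl => u; rewrite andbF orbF.
rewrite orbF => nP; rewrite (bigID (pred1 s)) /= addrC; congr (_ + _).
  apply: eq_bigl => u; rewrite andbT; case: eqVneq => [->|_] /=.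
    by rewrite andbF (negbTE nP).
  by rewrite orbF andbT.
rewrite (eq_bigl (pred1 s)) => [|u]; last by rewrite /= andbT; case: eqVneq; rewrite ?orbT ?andbF.
by rewrite -big_filter (filter_pred1_uniq (iota_uniq _ _)) ?mem_index_iota // big_seq1.
Qed.
End Peel.

(** * Moving the series of a top vertex through the ordered product *)

Section ProductOverArcs.
Variables (k : fieldType) (n' : nat) (disp : Order.disp_t) (R : orderType disp).
Local Notation n := n'.+1.
Local Notation T := (qtring k n).
Local Notation dims := {ffun 'I_n -> nat}.
Local Notation D j := (scaleby (coord (vt n' j))).
Local Notation W := (@arcw k n').
Variables (ph : nat -> nat -> R) (c : nat) (Ls : seq (nat * nat)).
Hypotheses (ph_seesaw : seesaw ph) (nc : (n <= c)%N).
Hypothesis cut : forall t, (c < t < c + n)%N -> (ph c t < ph c (c + n))%O.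
Hypothesis LsE : forall s t,
  ((s, t) \in Ls) = [&& (c <= s)%N, (t <= c + n)%N, stab ph s t & (s, t) != (c, c + n)%N].
Hypothesis Ls_sorted : pairwise (fun x y => (ph y.1 y.2 < ph x.1 x.2)%O) Ls.

Definition arc_prod (l : seq (nat * nat)) : T := \prod_(x <- l) qdilog k (arc n' x.1 x.2).

Section Peeling.
Variable m : nat.
Hypothesis cm : (c < m <= c + n)%N.

Let ok u := ~~ ((u == c) && (m == c + n)%N).

Definition coverV (l : seq (nat * nat)) : T :=
  1 + \sum_(c <= u < m | ok u && covered ph m l u) W u m.

(** Surviving arcs start outside [[s, t)], so they pass the dilogarithm unchanged except [[t, m)],
    which creates [W s m]. When [t = m], the same term comes from the scaling of the dilogarithm
    itself. This is exactly the change recorded by [covered_cons]. *)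
Lemma coverV_cons s t l :
    lower_part ph Ls m ((s, t) :: l) -> {subset (s, t) :: l <= Ls} ->
    (forall x, x \in (s, t) :: l -> (x.2 <= m)%N) ->
    (forall y, y \in l -> (ph y.1 y.2 < ph s t)%O) ->
  D m.-1 (qdilog k (arc n' s t)) * coverV l
  = coverV ((s, t) :: l) * qdilog k (arc n' s t).
Proof.
move=> Hl sub subm srt; set E := qdilog k _.
have /andP[cm1 cm2] := cm; have c0 : (0 < c)%N by lia.
have := sub _ (mem_head _ _); rewrite LsE => /and4P[cs tn /stabP[st _] ne].
move/eqP: ne => ne; have tm : (t <= m)%N := subm _ (mem_head _ _).
have cst : (c <= s < t)%N by rewrite cs.
have disj u := @covered_disjoint n' _ _ _ ph_seesaw _ _ LsE _ cm _ _ _ sub subm srt u.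
have below u := @covered_below n' _ _ _ ph_seesaw _ _ cut LsE _ cm _ _ _ sub subm srt u.
have cons u := @covered_cons n' _ _ _ ph_seesaw _ _ LsE _ cm _ _ _ Hl sub subm srt u.
have nls : ~~ covered ph m l s.
  by apply/negP => h; have := disj s h; rewrite leqnn st => /(_ _)/negP; apply; lia.
have -> : coverV ((s, t) :: l) = 1 + \sum_(c <= u < m | (ok u && covered ph m l u)
     || ((u == s) && (ok s && ((t == m) || covered ph m l t)))) W u m.
  congr (_ + _); rewrite big_nat_cond [RHS]big_nat_cond; apply: eq_bigl => u.
  case: (boolP (c <= u < m)%N) => //= um; have [oku|nok] := boolP (ok u).
    rewrite cons /admissible ?um //=; case: eqP => //= us; first by rewrite -us oku.
  by case: eqP => // us; rewrite -us (negbTE nok).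
rewrite /coverV sum_or_eq; first last.
- by rewrite (negbTE nls) andbF.
- by lia.
rewrite mulrDr mulr1 mulrDl mul1r mulrDl.
have okP u : (c <= u < m)%N -> ok u -> ~ (u = c /\ m = (c + n)%N).
  by move=> _ /negP h [h1 h2]; apply: h; rewrite h1 h2 !eqxx.
set S := \sum_(c <= u < m | _) _.
case: (ltngtP t m) tm => // [tm|tm] _ /=; last first.
  have -> : ok s.
    by apply/negP => /andP[/eqP sc /eqP mc]; apply: ne; rewrite sc tm mc.
  have DS : D m.-1 E * S = S * E.
    rewrite big_distrr big_distrl /= big_nat_cond [RHS]big_nat_cond.
    apply: eq_bigr => u /andP[um /andP[oku cu]].
    apply: (D_qdilog_w k c0 cm2 cst _ ne um _ tm (okP _ um oku)); first by rewrite tm.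
    have := disj u cu (proj2 (andP um)); lia.
  rewrite DS (D_qdilog_eq k c0 cm2 cst (eq_leq tm) ne tm) -/E mulrDl mul1r /=.
  by rewrite -!addrA [W s t * E + _]addrC tm.
rewrite (D_qdilog_lt k c0 cm2 cst (ltnW tm) ne tm) -/E; congr (_ + _).
set b := ok s && _.
have tcm : (c <= t < m)%N by lia.
have okt : ok t by rewrite /ok negb_and; apply/orP; left; lia.
(* If [[s, m)] were the excluded full turn, [covered_below] would prevent [[t, m)] from being
   covered. *)
have bE : b = covered ph m l t.
  rewrite /b; case: (boolP (covered ph m l t)) => ct; last by rewrite andbF.
  rewrite andbT; apply/negP => /andP[/eqP sc /eqP mc].
  by have /negP := below t ct sc mc tm; apply; lia.
have -> : E * S = S * E + \sum_(c <= u < m | ok u && covered ph m l u)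
                            (if u == t then W s m * E else 0).
  rewrite big_distrr big_distrl -big_split /= big_nat_cond [RHS]big_nat_cond.
  apply: eq_bigr => u /andP[um /andP[oku cu]].
  rewrite (qdilog_w k c0 cm2 cst (ltnW tm) ne um _ tm _ (okP _ um oku)).
  - by rewrite mulrDl; case: eqP; rewrite ?mul0r.
  - have := disj u cu (proj2 (andP um)); lia.
  - by case=> sc mc; have /negP := below u cu sc mc (proj2 (andP um)); apply; lia.
congr (_ + _); rewrite -big_mkcondr /= bE; case: ifP => ct; last first.
  rewrite mul0r big_pred0 // => u; case: eqVneq; rewrite ?andbF // => ->.
  by rewrite ct andbF.
rewrite big_nat_cond (eq_bigl (pred1 t)) => [|u]; last first.
  by rewrite /=; case: eqVneq => [->|]; rewrite ?andbF // tcm okt ct.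
by rewrite -big_filter (filter_pred1_uniq (iota_uniq _ _)) ?mem_index_iota // big_seq1.
Qed.

Lemma coverV_nil : coverV [::] = 1.
Proof.
rewrite /coverV big_nat_cond big_pred0 ?addr0 // => u.
apply/negbTE/negP => /andP[um /andP[_ /coveredP H]].
have um' : (u < u.+1 <= m)%N by lia.
by have := H u.+1 um' (stabS ph u); rewrite in_nil.
Qed.

Lemma lower_part_behead x l : {subset x :: l <= Ls} ->
    (forall y, y \in l -> (ph y.1 y.2 < ph x.1 x.2)%O) ->
  lower_part ph Ls m (x :: l) -> lower_part ph Ls m l.
Proof.
move=> sub srt H y yL ym; have [|h] := H y yL ym.
  by rewrite in_cons => /orP[/eqP ->|]; [right|left].
by right => t tl; apply: h; rewrite in_cons tl orbT.
Qed.

Lemma peel l :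
    lower_part ph Ls m l -> {subset l <= Ls} -> (forall x, x \in l -> (x.2 <= m)%N) ->
    pairwise (fun x y => (ph y.1 y.2 < ph x.1 x.2)%O) l ->
  D m.-1 (arc_prod l) = coverV l * arc_prod l.
Proof.
elim: l => [|[s t] l IH] Hl sub subm.
  by rewrite coverV_nil /arc_prod big_nil (scaleby1 _ (coordD _)) mul1r.
rewrite /= => /andP[/allP srt pw].
have {}IH : D m.-1 (arc_prod l) = coverV l * arc_prod l.
  apply: IH pw; first exact: lower_part_behead Hl.
    by move=> x xl; apply: sub; rewrite in_cons xl orbT.
  by move=> x xl; apply: subm; rewrite in_cons xl orbT.
rewrite /arc_prod big_cons (scalebyM (coordD _)) /= -/(arc_prod l) IH mulrA.
by rewrite coverV_cons // mulrA.
Qed.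

Lemma coverV_full l : (forall x, x \in Ls -> (x.2 <= m)%N -> x \in l) ->
  coverV l = 1 + \sum_(c <= u < m | ok u) W u m.
Proof.
move=> H; congr (_ + _); rewrite big_nat_cond [RHS]big_nat_cond; apply: eq_bigl => u.
case: (boolP (c <= u < m)%N) => //= um; case: (boolP (ok u)) => //= oku.
apply/coveredP => t ut st; apply: H; rewrite /= ?LsE ?st ?xpair_eqE.
  by move: oku; rewrite /ok; lia.
by lia.
Qed.

End Peeling.

End ProductOverArcs.

(** * Windows of the cut cycle and the system for the whole product *)

Lemma vt_window n' c (i : 'I_n'.+1) :
  exists2 j, (c <= j < c + n'.+1)%N & i = vt n' j.
Proof.
exists (c + (i + n'.+1 - c %% n'.+1) %% n'.+1)%N.
  by rewrite leq_addr ltn_add2l ltn_mod.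
rewrite -(vt_val i); apply/eqP; rewrite vt_eq modnDmr -modnDml.
by rewrite subnKC ?vt_val ?modnDr //; have := ltn_pmod c (ltn0Sn n'); lia.
Qed.

Section Window.
Variables (n' c m : nat).
Local Notation n := n'.+1.
Hypothesis mc : (m <= c + n)%N.

Definition window : {set 'I_n} := [set i | has (fun j => i == vt n' j) (index_iota c m)].

Lemma window_vt j : (c <= j < c + n)%N -> (vt n' j \in window) = (j < m)%N.
Proof.
move=> jc; rewrite inE; apply/hasP/idP => [[x]|jm].
  rewrite mem_index_iota => xm; rewrite (@vt_inj_window _ c) //; last by lia.
  by move=> /eqP ->; lia.
by exists j => //; rewrite mem_index_iota jm andbT; lia.
Qed.

Lemma supported_arc s t : (c <= s < t)%N -> (t <= c + n)%N ->
  supported window (arc n' s t) = (t <= m)%N.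
Proof.
move=> st tc; apply/forallP/idP => [H|tm i].
  have := H (vt n' t.-1); rewrite window_vt; last by lia.
  rewrite arc_vt; [|lia|lia]; lia.
have [j jc ->] := vt_window c i.
rewrite window_vt //; have [jm|jm] := ltnP j m; first by [].
have [js|sj] := ltnP j s; first by lia.
by rewrite arc_vt; lia.
Qed.

End Window.

Section ArcProductSystem.
Variables (k : fieldType) (n' : nat) (disp : Order.disp_t) (R : orderType disp).
Local Notation n := n'.+1.
Local Notation T := (qtring k n).
Local Notation dims := {ffun 'I_n -> nat}.
Local Notation D j := (scaleby (coord (vt n' j))).
Local Notation W := (@arcw k n').
Variables (ph : nat -> nat -> R) (c : nat) (Ls : seq (nat * nat)).
Hypotheses (ph_seesaw : seesaw ph) (nc : (n <= c)%N).
Hypothesis cut : forall t, (c < t < c + n)%N -> (ph c t < ph c (c + n))%O.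
Hypothesis LsE : forall s t,
  ((s, t) \in Ls) = [&& (c <= s)%N, (t <= c + n)%N, stab ph s t & (s, t) != (c, c + n)%N].
Hypothesis Ls_sorted : pairwise (fun x y => (ph y.1 y.2 < ph x.1 x.2)%O) Ls.

Local Notation window := (window n' c).
Local Notation E := (@arc_prod k n' Ls).

Lemma Ls_arc x : x \in Ls -> (c <= x.1 < x.2)%N /\ (x.2 <= c + n)%N.
Proof. by case: x => s t; rewrite LsE => /and4P[-> -> /stabP[-> _] _]. Qed.

Lemma truncate_arc_prod m : (c <= m <= c + n)%N ->
  truncate (window m) E = @arc_prod k n' [seq x <- Ls | x.2 <= m]%N.
Proof.
move=> cm; rewrite /arc_prod big_filter big_mkcond /=.
have : all (fun x => x \in Ls) Ls by apply/allP.
elim: {2 3 4}Ls => [|[s t] l IH]; first by rewrite !big_nil truncate1.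
rewrite /= => /andP[/Ls_arc /= [st tc] /IH {}IH].
have mc : (m <= c + n)%N by lia.
rewrite !big_cons truncateM IH truncate_qdilog /=; last by apply: arc_neq0; lia.
by rewrite (supported_arc mc st tc); case: ifP => //; rewrite mul1r.
Qed.

Lemma truncate_V m : (c < m <= c + n)%N ->
  truncate (window m) (arcV k m)
  = 1 + \sum_(c <= u < m | ~~ ((u == c) && (m == c + n)%N)) W u m.
Proof.
move=> cm; have mc : (m <= c + n)%N by lia.
rewrite /arcV big_nat_recr /=; last by lia.
rewrite w_nil truncateD truncate1 addrC truncate_sum; congr (_ + _).
(* Arcs starting before [c] contain the vertex [c - 1], that is [c + n'], which is outside the
   window whenever such arcs occur. *)
rewrite (@big_cat_nat _ _ _ (maxn c (m - n'))) /=; [|lia|lia].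
rewrite big_nat big1 ?add0r => [|a am].
  rewrite [RHS](@big_cat_nat _ _ _ (maxn c (m - n'))) /=; [|lia|lia].
  rewrite [X in _ = X + _]big_nat_cond [X in _ = X + _]big_pred0 ?add0r => [|u]; last by lia.
  rewrite big_nat [RHS]big_nat_cond; apply: eq_big => [u|a am]; first by lia.
  rewrite w_short ?truncateZ ?truncate_mon; last by lia.
  by rewrite (supported_arc mc) ?leqnn //; lia.
rewrite w_short ?truncateZ ?truncate_mon; last by lia.
case: ifP => [/forallP/(_ (vt n' (c + n')))|]; last by rewrite scaler0.
rewrite (window_vt mc); last by lia.
rewrite (_ : (c + n' = c.-1 + n)%N); last by lia.
by rewrite vt_addn arc_vt; lia.
Qed.

Lemma truncate_top_out (A : {set 'I_n}) (i : 'I_n) : i \notin A -> truncate A (topV k i) = 1.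
Proof.
move=> iA; rewrite /topV /arcV big_nat_recr /=; last by lia.
rewrite w_nil truncateD truncate1 truncate_sum big_nat big1 ?add0r // => a am.
rewrite w_short ?truncateZ ?truncate_mon; last by lia.
case: ifP => [/forallP/(_ i)|]; last by rewrite scaler0.
by rewrite (negbTE iA) -[X in arc _ _ _ X](vt_val i) -(vt_addn n' i) arc_vt; lia.
Qed.

Lemma truncate_scale_out (A : {set 'I_n}) (i : 'I_n) (f : T) : i \notin A ->
  truncate A (scaleby (coord i) f) = truncate A f.
Proof.
move=> iA; apply: funext => e; rewrite /truncate /scaleby; case: ifP => // /forallP/(_ i).
by rewrite (negbTE iA) /coord => /= /eqP ->; rewrite expr0z mul1r.
Qed.

Lemma truncate_peel m : (c < m <= c + n)%N ->
  truncate (window m) (D m.-1 E) = truncate (window m) (topV k (vt n' m.-1) * E).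
Proof.
move=> cm; have cm' : (c <= m <= c + n)%N by lia.
rewrite topV_vt ?prednK; [|lia|lia].
rewrite truncate_scaleby truncateM truncate_V // truncate_arc_prod //.
have sub : {subset [seq x <- Ls | x.2 <= m]%N <= Ls}.
  by move=> x; rewrite mem_filter => /andP[].
rewrite (peel k ph_seesaw nc cut LsE Ls_sorted cm) //.
- rewrite (coverV_full k nc LsE Ls_sorted cm) // => x xL xm.
  by rewrite mem_filter xm.
- by move=> x xL xm; left; rewrite mem_filter xm.
- by move=> x; rewrite mem_filter => /andP[].
- by apply: pairwise_filter.
Qed.

(** Let X be the defect of the [i]-th equation. The [j]-th equation and flatness give D_j X =
    D_i(V_j) X on [A]; as X vanishes on [A :\ j], [truncate_eq0] applies. *)
Lemma truncate_coord_swap (A : {set 'I_n}) (i j : 'I_n) (f : T) :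
    truncate A (scaleby (coord j) f) = truncate A (topV k j * f) ->
    truncate (A :\ j) (scaleby (coord i) f) = truncate (A :\ j) (topV k i * f) ->
  truncate A (scaleby (coord i) f) = truncate A (topV k i * f).
Proof.
move=> Hj Hi; apply/eqP; rewrite -subr_eq0 -truncateB; apply/eqP.
apply: (@truncate_eq0 _ _ A j (scaleby (coord i) (topV k j))).
- by rewrite /scaleby topV_coef0 /coord ffunE expr0z mulr1.
- rewrite scalebyB mulrBr !truncateB; congr (_ - _).
    by rewrite scaleby_comm truncate_scaleby Hj -truncate_scaleby (scalebyM (coordD _)).
  by rewrite (scalebyM (coordD _)) truncateM Hj -truncateM !mulrA topV_flat.
- by rewrite truncateB Hi subrr.
Qed.

Lemma window_setD1 m : (c <= m < c + n)%N -> window m.+1 :\ vt n' m = window m.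
Proof.
move=> cm; apply/setP => i; rewrite in_setD1.
have [j jc ->] := vt_window c i.
rewrite !window_vt //; [|lia|lia].
by rewrite (@vt_inj_window _ c) //; lia.
Qed.

Lemma truncate_arc_prod_system m (i : 'I_n) : (c <= m <= c + n)%N ->
  truncate (window m) (scaleby (coord i) E) = truncate (window m) (topV k i * E).
Proof.
elim: m => [|m IH] cm; first by lia.
have [cm'|mc] := leqP c m; last first.
  have iw : i \notin window m.+1.
    have [j jc ->] := vt_window c i; rewrite window_vt //; lia.
  by rewrite truncate_scale_out // truncateM truncate_top_out // mul1r.
have [iw|iw] := boolP (i \in window m.+1); last first.
  by rewrite truncate_scale_out // truncateM truncate_top_out // mul1r.
have P : truncate (window m.+1) (D m E) = truncate (window m.+1) (topV k (vt n' m) * E).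
  by apply: (@truncate_peel m.+1); lia.
have [->|im] := eqVneq i (vt n' m); first exact: P.
apply: truncate_coord_swap P _; rewrite window_setD1; last by lia.
by apply: IH; lia.
Qed.

Lemma arc_prod_system (i : 'I_n) : scaleby (coord i) E = topV k i * E.
Proof.
have full (f : T) : truncate (window (c + n)) f = f.
  apply: funext => e; rewrite /truncate; case: ifP => // /negbT/forallP[] j.
  have [x xc ->] := vt_window c j; rewrite window_vt //; lia.
by rewrite -[LHS]full truncate_arc_prod_system ?full //; lia.
Qed.

Lemma arc_prod_coef0 : E 0 = 1.
Proof.
have nil0 : truncate set0 E = 1.
  rewrite /arc_prod; have : all (fun x => x \in Ls) Ls by apply/allP.
  elim: {2 3}Ls => [|[s t] l IH]; first by rewrite big_nil truncate1.
  rewrite /= => /andP[/Ls_arc /= [st tc] /IH {}IH].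
  rewrite big_cons truncateM IH mulr1 truncate_qdilog /=; last by apply: arc_neq0; lia.
  case: ifP => // /forallP/(_ (vt n' s)); rewrite inE arc_vt /=; lia.
have := congr1 (fun f : T => f 0) nil0; rewrite oneqE eqxx /truncate ifT //.
by apply/forallP => i; rewrite ffunE eqxx orbT.
Qed.

End ArcProductSystem.

(** * Arguments of complex numbers *)

Section Argument.
Variable R : realType.
Implicit Types z w : R[i].

Definition half_plane z := (0 < complex.Im z) || ((complex.Im z == 0) && (0 < complex.Re z)).

(** Bilinear, and its sign compares arguments in the half plane ([arg_lt]); this linearises
    inequalities between phases. *)
Definition cross z w : R := complex.Re z * complex.Im w - complex.Im z * complex.Re w.

Lemma crossDl x y w : cross (x + y) w = cross x w + cross y w.
Proof. by case: x y => [a b] [c d]; rewrite /cross /=; ring. Qed.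

Lemma crossC x y : cross x y = - cross y x.
Proof. by rewrite /cross; ring. Qed.

Lemma crossDr x y w : cross w (x + y) = cross w x + cross w y.
Proof. by rewrite crossC crossDl opprD -!crossC. Qed.

Lemma crossvv x : cross x x = 0.
Proof. by rewrite /cross; ring. Qed.

(** On the upper half circle the sign is found by comparing squares, whose difference is a^2 - c^2.
    The point -1 must be excluded: its determinant against 1 vanishes. *)
Lemma unit_cross (a b c d : R) : 0 <= b -> 0 <= d -> a ^+ 2 + b ^+ 2 = 1 ->
    c ^+ 2 + d ^+ 2 = 1 -> a != - 1 -> c != - 1 ->
  (c < a) = (0 < a * d - b * c).
Proof.
move=> b0 d0 ab cd a1 c1.
have key x y x' y' : 0 <= y -> 0 <= y' -> x ^+ 2 + y ^+ 2 = 1 ->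
    x' ^+ 2 + y' ^+ 2 = 1 -> x' != - 1 -> x' < x -> 0 < x * y' - y * x' :> R.
  move=> y0 y0' xy xy' x1 lt.
  have sqlt (u v : R) : u ^+ 2 < v ^+ 2 -> 0 <= v -> u < v.
    by move=> h v0; rewrite -subr_gt0; nra.
  have sqE : (x * y') ^+ 2 - (y * x') ^+ 2 = (x - x') * (x + x').
    have -> : (x * y') ^+ 2 - (y * x') ^+ 2 = x ^+ 2 * y' ^+ 2 - y ^+ 2 * x' ^+ 2 by ring.
    have -> : y ^+ 2 = 1 - x ^+ 2 by lra.
    have -> : y' ^+ 2 = 1 - x' ^+ 2 by lra.
    by ring.
  have dx : 0 < x - x' by lra.
  have y'p : x' < 0 -> 0 < y'.
    move=> x'0; rewrite lt_neqAle y0' andbT; apply/eqP => E; rewrite -E in xy'.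
    have : (x' - 1) * (x' + 1) = 0 by lra.
    by move/eqP; rewrite mulf_eq0 => /orP[|] /eqP h; [lra|case/eqP: x1; lra].
  have [x0|x0] := lerP x 0.
    suff : - (x * y') < - (y * x') by lra.
    apply: sqlt; last by nra.
    have : 0 < (x - x') * - (x + x') by apply: mulr_gt0; lra.
    by rewrite !sqrrN; lra.
  have [x'0|x'0] := lerP 0 x'.
    rewrite subr_gt0; apply: sqlt; last by apply: mulr_ge0; lra.
    have : 0 < (x - x') * (x + x') by apply: mulr_gt0; lra.
    by lra.
  have : 0 < x * y' by apply: mulr_gt0 => //; exact: y'p.
  have : y * x' <= 0 by apply: mulr_ge0_le0; lra.
  by lra.
case: (ltgtP c a) => [lt|lt|E].
- by apply/esym; apply: key.
- have := @key c d a b d0 b0 cd ab a1 lt => h; apply/esym/negbTE; rewrite -leNgt; lra.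
- have bd : b = d.
    have : (b - d) * (b + d) = 0 by rewrite E in cd; lra.
    by move/eqP; rewrite mulf_eq0 => /orP[|] /eqP h; lra.
  by rewrite E bd; apply/esym/negbTE; rewrite -leNgt; lra.
Qed.

Definition cnorm z : R := Num.sqrt (complex.Re z ^+ 2 + complex.Im z ^+ 2).

Lemma cnorm2 z : cnorm z ^+ 2 = complex.Re z ^+ 2 + complex.Im z ^+ 2.
Proof. by rewrite sqr_sqrtr // addr_ge0 ?sqr_ge0. Qed.

Lemma cnorm_gt0 z : z != 0 -> 0 < cnorm z.
Proof.
case: z => a b nz; rewrite sqrtr_gt0 /= lt_neqAle addr_ge0 ?sqr_ge0 // andbT eq_sym.
rewrite paddr_eq0 ?sqr_ge0 // !sqrf_eq0; apply: contra nz => /andP[/eqP -> /eqP ->].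
by [].
Qed.

Lemma cnorm_unit z : z != 0 ->
  (complex.Re z / cnorm z) ^+ 2 + (complex.Im z / cnorm z) ^+ 2 = 1.
Proof.
move=> /cnorm_gt0 p; rewrite !exprMn -mulrDl -cnorm2 -exprMn divff ?expr1n //.
by rewrite gt_eqF.
Qed.

Lemma cnorm_Re_itv z : z != 0 -> -1 <= complex.Re z / cnorm z <= 1.
Proof. by move=> /cnorm_unit; move: (_ / _) (_ / _) => x y h; apply/andP; nra. Qed.

Lemma half_plane_neq0 z : half_plane z -> z != 0.
Proof. by apply: contraTneq => ->; rewrite /half_plane /= ltxx eqxx. Qed.

Lemma half_plane_ReN1 z : half_plane z -> complex.Re z / cnorm z != -1.
Proof.
move=> hz; have nz := half_plane_neq0 hz; have p := cnorm_gt0 nz.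
apply/eqP => E; have := cnorm_unit nz; rewrite E => h.
have /eqP : (complex.Im z / cnorm z) ^+ 2 = 0 by lra.
rewrite sqrf_eq0 mulf_eq0 invr_eq0 (gt_eqF p) orbF => /eqP I0.
move: hz; rewrite /half_plane I0 ltxx eqxx /= => Re0.
by have := divr_gt0 Re0 p; rewrite E; lra.
Qed.

Lemma half_plane_Im z : half_plane z -> 0 <= complex.Im z.
Proof. by case/orP => [/ltW//|/andP[/eqP ->]]. Qed.

Lemma arg_lt z w : half_plane z -> half_plane w -> (arg z < arg w) = (0 < cross z w).
Proof.
move=> hz hw; have nz := half_plane_neq0 hz; have nw := half_plane_neq0 hw.
rewrite /arg !half_plane_Im // -!/(cnorm _).
rewrite -ltr_cos ?in_itv /= ?acos_ge0 ?acos_lepi ?cnorm_Re_itv //.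
rewrite !acosK ?in_itv /= ?cnorm_Re_itv //.
have pz := cnorm_gt0 nz; have pw := cnorm_gt0 nw.
rewrite (@unit_cross _ (complex.Im z / cnorm z) _ (complex.Im w / cnorm w)) ?cnorm_unit
  ?half_plane_ReN1 ?divr_ge0 ?half_plane_Im ?ltW //.
have -> : cross z w = (complex.Re z / cnorm z * (complex.Im w / cnorm w)
   - complex.Im z / cnorm z * (complex.Re w / cnorm w)) * (cnorm z * cnorm w).
  by rewrite /cross; field; rewrite !gt_eqF.
by rewrite pmulr_lgt0 // mulr_gt0.
Qed.

Lemma arg_eq z w : half_plane z -> half_plane w -> (arg z == arg w) = (cross z w == 0).
Proof.
move=> hz hw; rewrite eq_le !leNgt !arg_lt // crossC oppr_gt0 -!leNgt.
by rewrite eq_le andbC.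
Qed.

Lemma half_planeP z : z != 0 -> 0 <= arg z < pi -> half_plane z.
Proof.
move=> nz; have itv := cnorm_Re_itv nz; have p := cnorm_gt0 nz.
rewrite /arg -/(cnorm z) /half_plane; case: (ltgtP (complex.Im z) 0) => [I0|//|I0] /=.
  rewrite oppr_ge0 => /andP[le _].
  have E : acos (complex.Re z / cnorm z) = 0 by apply/eqP; rewrite eq_le le acos_ge0.
  have := acosK (x := complex.Re z / cnorm z); rewrite in_itv /= => /(_ itv).
  rewrite E cos0 => E1; have := cnorm_unit nz; rewrite -E1 => h.
  have /eqP : (complex.Im z / cnorm z) ^+ 2 = 0 by lra.
  by rewrite sqrf_eq0 mulf_eq0 invr_eq0 (gt_eqF p) orbF lt_eqF.
move=> /andP[_ lt]; rewrite ltNge; apply/negP => Re0.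
have E : complex.Re z / cnorm z = - 1.
  have := cnorm_unit nz; rewrite I0 mul0r expr0n addr0.
  have : complex.Re z / cnorm z <= 0 by rewrite pmulr_lle0 ?invr_gt0.
  move: (_ / _) => x x0 h; have : (x - 1) * (x + 1) = 0 by lra.
  by move/eqP; rewrite mulf_eq0 => /orP[|] /eqP h'; lra.
by move: lt; rewrite E acosN1 ltxx.
Qed.

End Argument.

Lemma class_ofD n (d e : {ffun 'I_n -> nat}) : class_of (d + e) = class_of d + class_of e.
Proof. by apply/ffunP => i; rewrite !ffunE PoszD. Qed.

(** * Phases of arcs and the choice of the cut *)

Section Polygon.
Variables (n' : nat) (R : realType).
Local Notation n := n'.+1.
Local Notation dims := {ffun 'I_n -> nat}.
Variable Z : {additive G0 n -> R[i]}.
Hypothesis Zpos : forall d : dims, d != 0 -> half_plane (Z (class_of d)).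

Let z a b := Z (class_of (arc n' a b)).
Definition arc_phase a b : R := arg (Z (class_of (arc n' a b))).
Local Notation ph := arc_phase.

Let z_cat a b c : (a <= b <= c)%N -> z a c = z a b + z b c.
Proof. by move=> abc; rewrite /z (arc_cat _ abc) class_ofD raddfD. Qed.

Lemma arc_neq0_gen a b : (a < b)%N -> arc n' a b != 0.
Proof.
move=> ab; rewrite (@arc_cat _ a a.+1 b) ?arc1; last by lia.
apply/eqP => /(congr1 (fun d : dims => d (vt n' a))); rewrite !ffunE eqxx.
by rewrite -[GRing.add]/addn.
Qed.

Let z_half a b : (a < b)%N -> half_plane (z a b).
Proof. by move=> ab; apply/Zpos/arc_neq0_gen. Qed.

Let ph_lt a b c d : (a < b)%N -> (c < d)%N -> (ph a b < ph c d) = (0 < cross (z a b) (z c d)).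
Proof. by move=> ab cd; apply: arg_lt; apply: z_half. Qed.

(** The value of Z on [[a, c)] is the sum over the two parts, so its cross product with either part
    reduces to that of the parts. *)
Lemma arc_phase_seesaw : seesaw ph.
Proof.
move=> a b c abc; have [ab bc ac] : [/\ a < b, b < c & a < c]%N by split; lia.
have E : z a c = z a b + z b c by apply: z_cat; lia.
split.
- by rewrite !ph_lt // E crossDl crossDr !crossvv add0r addr0 => ->.
- by rewrite !ph_lt // E crossDl crossDr !crossvv add0r addr0 => ->.
move=> /eqP; rewrite arg_eq ?z_half // -/(z _ _) -/(z _ _) => /eqP h.
by apply/eqP; rewrite arg_eq ?z_half // -/(z _ _) E crossDl crossvv crossC h oppr0 addr0.
Qed.

Lemma arc_phase_shift a b : ph (a + n) (b + n) = ph a b.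
Proof. by rewrite /arc_phase arc_shift. Qed.

Lemma stab_shift a b : stab ph (a + n) (b + n) = stab ph a b.
Proof.
apply/stabP/stabP => -[ab H]; split; try lia.
  move=> t tab; rewrite -!(arc_phase_shift a); apply: H; lia.
move=> t tab; rewrite -(subnK (_ : n <= t)%N); last by lia.
by rewrite !arc_phase_shift; apply: H; lia.
Qed.

Lemma arc_full a : arc n' a (a + n) = delta n.
Proof.
apply/ffunP => i; have [j ja ->] := vt_window a i.
by rewrite arc_vt // ffunE; case: (ltnP j (a + n)) => //; lia.
Qed.

Lemma arc_window c s t x : (c <= s <= t)%N -> (t <= c + n)%N -> (c <= x < c + n)%N ->
  arc n' s t (vt n' x) = (s <= x < t)%N.
Proof.
move=> st tc xc; have [sx|xs] := leqP s x.
  by rewrite arc_vt //; lia.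
by rewrite -(vt_addn n' x) arc_vt; lia.
Qed.

Lemma arc_inj c s t s' t' : (c <= s < t)%N -> (t <= c + n)%N ->
  (c <= s' < t')%N -> (t' <= c + n)%N -> arc n' s t = arc n' s' t' -> (s, t) = (s', t').
Proof.
move=> st tc st' tc' E.
have H x : (c <= x < c + n)%N -> (s <= x < t)%N = (s' <= x < t')%N.
  move=> xc; have := congr1 (fun d : dims => d (vt n' x)) E.
  by rewrite !(arc_window _ _ xc) //; [case: (s <= x < t)%N; case: (s' <= x < t')%N|lia|lia].
have := H s; have := H s'; have := H t.-1; have := H t'.-1.
by move=> h1 h2 h3 h4; congr (_, _); lia.
Qed.

Hypothesis disc : forall a b a' b', stab ph a b -> stab ph a' b' ->
  (b < a + n)%N -> (b' < a' + n)%N -> ph a b = ph a' b' -> arc n' a b = arc n' a' b'.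

Let phd : R := arg (Z (class_of (delta n))).

(** At a maximum of the periodic height [h], every arc starting there has phase at most that of
    delta; discreteness makes the inequality strict. *)
Lemma exists_cut : exists2 c, (n <= c)%N & forall t, (c < t < c + n)%N -> ph c t < ph c (c + n).
Proof.
pose zd := Z (class_of (delta n)); pose h t := cross zd (z 0 t).
have zdE a : z a (a + n) = zd by rewrite /z arc_full.
have hD s t : (s <= t)%N -> h t = h s + cross zd (z s t).
  by move=> st; rewrite /h (@z_cat 0 s t) ?crossDr //; lia.
have hn t : h (t + n) = h t by rewrite (hD t) ?zdE ?crossvv ?addr0 //; lia.
have [c0 /= hc0] : exists c0 : 'I_n, forall t : 'I_n, h t <= h c0.
  by case: (@Order.TotalTheory.arg_maxP _ _ _ (ord0 : 'I_n) predT (fun i : 'I_n =>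
      h i)) => // c0 _ H; exists c0 => t; apply: H.
pose c := (c0 + n)%N; have hc t : h t <= h c.
  rewrite hn (divn_eq t n) addnC; elim: (t %/ n)%N => [|m IH].
    by rewrite mul0n addn0; apply: (hc0 (Ordinal (ltn_pmod t (ltn0Sn n')))).
  by rewrite mulSn addnCA addnC hn.
exists c => [|t tc]; first by rewrite leq_addl.
have ph_le s u : h s = h c -> (s < u)%N -> ph s u <= phd.
  move=> hs su; rewrite leNgt /phd -(arc_full s) ph_lt ?zdE; [|lia|lia].
  by rewrite -leNgt; have := hc u; rewrite (hD s u) ?hs //; [lra|lia].
rewrite lt_neqAle; have -> : ph c (c + n) = phd by rewrite /arc_phase arc_full.
rewrite ph_le ?andbT //; last by lia.
(* In case of equality [[t, c + n)] also has the phase of delta, and both pieces contain stable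
   initial arcs of this phase. Only the first of them contains the vertex [c], against [disc]. *)
apply/eqP => E.
have ct : (c < t)%N by lia.
have tcn : (t < c + n)%N by lia.
have ht : h t = h c.
  have /eqP := E; rewrite /phd -(arc_full c) arg_eq ?z_half //; last by lia.
  rewrite -/(z _ _) -/(z _ _) zdE crossC oppr_eq0 => /eqP E'.
  by rewrite (hD c t) ?E' ?addr0 // ltnW.
have E2 : ph t (c + n) = phd.
  apply/eqP; rewrite /phd -(arc_full c) arg_eq ?z_half //; last by lia.
  have : h (c + n) = h t by rewrite hn ht.
  rewrite (hD t (c + n)) -/(z _ _) -/(z _ _) ?zdE ?(ltnW tcn) // crossC.
  by move=> h'; apply/eqP; lra.
have [t1 [ct1 st1 le1]] := max_stab ph ct.
have [t2 [ct2 st2 le2]] := max_stab ph tcn.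
have E1' : ph c t1 = phd by apply/le_anti; rewrite -{2}E le1 ph_le //; lia.
have E2' : ph t t2 = phd by apply/le_anti; rewrite -{2}E2 le2 ph_le //; lia.
have b1 : (t1 < c + n)%N by lia.
have b2 : (t2 < t + n)%N by lia.
have := disc st1 st2 b1 b2 (etrans E1' (esym E2')).
move=> /(congr1 (fun d : dims => d (vt n' c))).
rewrite arc_vt; [|lia|lia].
rewrite -(vt_addn n' c) arc_vt; [|lia|lia].
lia.
Qed.

(** Stability of [[a, b)] puts the phase of [[a, c + n)] below that of [[c + n, b)]. The cut forces
    the reverse: the former is a quotient of the full turn at [c], the latter, one turn back, a
    proper subobject of it. *)
Lemma stab_no_crossing c a b : (forall t, (c < t < c + n)%N -> ph c t < ph c (c + n)) ->
    (c <= a < c + n)%N -> (b < a + n)%N -> stab ph a b ->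
  (b <= c + n)%N.
Proof.
move=> cut ac ba /stabP[ab st]; rewrite leqNgt; apply/negP => cb.
have sw := seesaw_quot arc_phase_seesaw; have sw' := seesaw_sub arc_phase_seesaw.
have h1 : ph a (c + n) < ph a b by apply: st; lia.
have h2 : ph c a < ph c (c + n) by apply: cut; lia.
have h3 : ph c (b - n) < ph c (c + n) by apply: cut; lia.
rewrite -sw in h2; last by lia.
rewrite -sw' in h1; last by lia.
rewrite -(arc_phase_shift c (b - n)) subnK in h3; last by lia.
by have := lt_trans h1 (lt_trans h3 h2); rewrite ltxx.
Qed.

End Polygon.

(** * Nilpotent representations *)

Section Representations.
Variables (k : fieldType) (n' : nat).
Local Notation n := n'.+1.
Local Notation dims := {ffun 'I_n -> nat}.
Implicit Types X Y M : rep k n.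

Lemma iter_ordS_vt j s : iter j (@ordS n) (vt n' s) = vt n' (s + j).
Proof. by elim: j => [|j IH]; rewrite ?addn0 // iterS IH ordS_vt addnS. Qed.

Lemma iter_ordS_n (i : 'I_n) : iter n (@ordS n) i = i.
Proof. by rewrite -(vt_val i) iter_ordS_vt vt_addn. Qed.

Definition zero_rep (d : dims) : rep k n := @Rep k n d (fun _ => 0).

Lemma zero_rep_nilpotent d : nilpotent_rep (zero_rep d).
Proof. by exists 1 => i; rewrite /= mul0mx. Qed.

Section Steps.
Variable X : rep k n.
Local Notation d := (dimvec X).

(* Tagging vectors by their vertex makes the arrows one total operator, so    *)
(* that composites of paths need no casts between equal vertices.             *)
Definition hvec := {i : 'I_n & 'rV[k]_(d i)}.

Definition hstep (x : hvec) : hvec :=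
  Tagged (fun i => 'rV_(d i)) (conform_mx 0 (tagged x) *m mor X (ord_pred (tag x))).

Definition hv i (u : 'rV[k]_(d i)) : hvec := Tagged (fun i => 'rV_(d i)) u.

Lemma hv_inj i : injective (@hv i).
Proof. by move=> u v /eqP; rewrite eq_Tagged => /eqP. Qed.

Lemma hv_conform i j (u : 'rV_(d i)) : i = j -> hv (conform_mx (0 : 'rV_(d j)) u) = hv u.
Proof. by move=> E; case: j / E; rewrite conform_mx_id. Qed.

Lemma hstep_mor i (u : 'rV_(d (ordS i))) : hstep (hv u) = hv (u *m mor X i).
Proof.
rewrite /hstep /= (_ : ord_pred (ordS i) = i) ?conform_mx_id //; exact: ordSK.
Qed.

Lemma hstep_path m i (u : 'rV_(d (iter m (@ordS n) i))) :
  iter m hstep (hv u) = hv (u *m pathmx X m i).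
Proof.
elim: m u => [|m IH] u; first by rewrite /= mulmx1.
by rewrite iterSr hstep_mor IH /= mulmxA.
Qed.

Lemma hstep_path_tag m i (x : hvec) : tag x = iter m (@ordS n) i ->
  exists u, iter m hstep x = hv (u *m pathmx X m i).
Proof.
case: x => j u /= /esym E; case: j / E u => u.
by exists u; exact: hstep_path.
Qed.

Definition hzero (x : hvec) := tagged x == 0.

Lemma hzero_step x : hzero x -> hzero (hstep x).
Proof.
case: x => i u /eqP /= ->; rewrite /hzero /hstep /=; apply/eqP.
rewrite (_ : conform_mx 0 0 = 0) ?mul0mx //.
by rewrite /conform_mx; case: eqP => // e1; case: eqP => // e2; rewrite castmx_const.
Qed.

Lemma hzero_iter x m : hzero x -> hzero (iter m hstep x).
Proof. by elim: m => //= m IH /IH; exact: hzero_step. Qed.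

Lemma iter_ord_predK m (i : 'I_n) : iter m (@ordS n) (iter m (@ord_pred n) i) = i.
Proof. by elim: m i => // m IH i; rewrite iterSr iterS ord_predK IH. Qed.

Lemma hstep_nilpotent m : (forall i, pathmx X m i = 0) -> forall x, hzero (iter m hstep x).
Proof.
move=> N x; have [u ->] := @hstep_path_tag m (iter m (@ord_pred n) (tag x)) x (esym
    (iter_ord_predK _ _)).
by rewrite N mulmx0 /hzero.
Qed.

End Steps.

Lemma subrep_exists (X : nilrep k n) (r : 'I_n -> nat)
    (U : forall i, 'M[k]_(r i, dimvec X i)) :
    (forall i, (U (ordS i) *m mor X i <= U i)%MS) ->
  exists Y : nilrep k n, (forall i, dimvec Y i = \rank (U i)) /\
    exists f : forall i, 'M[k]_(dimvec Y i, dimvec X i),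
      morphism f /\ injective_mor f.
Proof.
move=> cl; pose e : dims := [ffun i => \rank (U i)].
have eE i : \rank (U i) = e i by rewrite ffunE.
pose f i : 'M[k]_(e i, dimvec X i) := castmx (eE i, erefl) (row_base (U i)).
have fU i : (f i :=: U i)%MS.
  by apply: eqmx_trans (eq_row_base _); apply: eqmx_cast.
have ff i : row_free (f i) by rewrite /row_free fU eE.
pose Y := @Rep k n e (fun i => f (ordS i) *m mor X i *m pinvmx (f i)).
have fm : @morphism k n Y X f.
  move=> i /=; rewrite mulmxKpV //.
  rewrite fU; apply: submx_trans (cl i); apply: submxMr; by rewrite fU.
have fpath m i : pathmx Y m i *m f i = f (iter m (@ordS n) i) *m pathmx X m i.
  elim: m i => [|m IH] i; first by rewrite /= mul1mx mulmx1.
  have -> : pathmx Y m.+1 i = mor Y (iter m (@ordS n) i) *m pathmx Y m i by [].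
  by rewrite -mulmxA IH mulmxA fm -mulmxA.
have Ynil : nilpotent_rep Y.
  have [m N] := nilrepP X; exists m => i.
  apply: (row_free_inj (ff i)); rewrite fpath N mulmx0 mul0mx //.
exists (Nilrep Ynil); split=> [i|]; first by rewrite /= ffunE.
by exists f.
Qed.

Lemma iso_dimvec X Y : iso_rep X Y -> dimvec X = dimvec Y.
Proof.
case=> f [_ fi fs]; apply/ffunP => i; have := fi i; have := fs i.
by rewrite /row_full /row_free => /eqP E1 /eqP E2; rewrite -E1 -{1}E2.
Qed.

Lemma iso_common X Y M : iso_rep X M -> iso_rep Y M -> iso_rep X Y.
Proof.
case=> f [fm fi fs] [g [gm gi gs]].
pose h i := f i *m pinvmx (g i); exists h.
have gV i : g i *m pinvmx (g i) = 1%:M by apply: mulmxVp.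
have Vg i : pinvmx (g i) *m g i = 1%:M by apply: mulVpmx.
have fV i : f i *m pinvmx (f i) = 1%:M by apply: mulmxVp.
have Vf i : pinvmx (f i) *m f i = 1%:M by apply: mulVpmx.
split.
- move=> i; rewrite /h mulmxA fm -[LHS]mulmxA -[RHS]mulmxA; congr (_ *m _).
  rewrite -[LHS]mul1mx -(Vg (ordS i)) -mulmxA [g _ *m (_ *m _)]mulmxA -gm.
  by rewrite -mulmxA gV mulmx1.
- move=> i; apply/row_freeP; exists (g i *m pinvmx (f i)).
  by rewrite /h mulmxA -(mulmxA (f i)) Vg mulmx1 fV.
- move=> i; apply/row_fullP; exists (g i *m pinvmx (f i)).
  by rewrite /h mulmxA -(mulmxA (g i)) Vf mulmx1 gV.
Qed.

End Representations.

(** * Dimension vectors of stable objects *)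

Section StableObjects.
Variables (k : fieldType) (n' : nat) (R : realType).
Local Notation n := n'.+1.
Local Notation dims := {ffun 'I_n -> nat}.
Variable Z : {additive G0 n -> R[i]}.
Hypothesis sZ : stability_function k Z.

Lemma stability_half_plane (d : dims) : d != 0 -> half_plane (Z (class_of d)).
Proof.
move=> nd; have nX : nonzero_rep (zero_rep k d).
  apply: contrapT => /forallNP H; case/eqP: nd; apply/ffunP => i.
  by have := H i; rewrite ffunE => /contrapT.
have [/eqP z0 ph] := sZ (X := Nilrep (zero_rep_nilpotent k d)) nX.
exact: half_planeP.
Qed.

Lemma nonzero_dimvec (X : nilrep k n) : nonzero_rep X -> dimvec X != 0.
Proof. by case=> i Hi; apply/eqP => E; apply: Hi; rewrite E ffunE. Qed.

Lemma proper_sub_of (X Y : nilrep k n) (f : forall i, 'M[k]_(dimvec Y i, dimvec X i)) i :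
  morphism f -> injective_mor f -> dimvec Y i != dimvec X i -> proper_subobject Y X.
Proof.
move=> fm fi ne; exists f; split=> // /(_ i); rewrite /row_full => /eqP E.
by case/eqP: ne; have := fi i; rewrite /row_free E => /eqP ->.
Qed.

Lemma stable_sub (X : nilrep k n) (r : 'I_n -> nat)
    (U : forall i, 'M[k]_(r i, dimvec X i)) i j :
    stable Z X -> (forall i, (U (ordS i) *m mor X i <= U i)%MS) ->
    \rank (U i) != 0%N -> \rank (U j) != dimvec X j ->
  exists2 d : dims, (forall i, d i = \rank (U i))
    & arg (Z (class_of d)) < arg (Z (class_of (dimvec X))).
Proof.
move=> [nX sX] cl ri rj; have [Y [dY [f [fm fi]]]] := subrep_exists cl.
exists (dimvec Y) => //; apply: (sX Y).
  by exists i; apply/eqP; rewrite dY.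
by apply: (proper_sub_of (i := j) fm fi); rewrite dY.
Qed.

(** Two nonzero subobjects would both have smaller phase than [X], although the phase of a sum
    cannot exceed both. Only ranks have to add up, so kernel and image of an endomorphism qualify as
    well as direct summands. *)
Lemma stable_split (X : nilrep k n) (r r' : 'I_n -> nat)
    (U : forall i, 'M[k]_(r i, dimvec X i)) (U' : forall i, 'M[k]_(r' i, dimvec X i)) :
    stable Z X -> (forall i, (U (ordS i) *m mor X i <= U i)%MS) ->
    (forall i, (U' (ordS i) *m mor X i <= U' i)%MS) ->
    (forall i, \rank (U i) + \rank (U' i) = dimvec X i)%N ->
    (exists i, \rank (U i) != 0%N) ->
  forall i, \rank (U' i) = 0%N.
Proof.
move=> sX cU cU' E [i ri] j; apply/eqP; apply: contraT => rj.
have [|d dE lt] := @stable_sub X _ U i j sX cU ri.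
  by move: (E j) rj; lia.
have [|d' dE' lt'] := @stable_sub X _ U' j i sX cU' rj.
  by move: (E i) ri; lia.
have XE : dimvec X = d + d' by apply/ffunP => x; rewrite -E -dE -dE' ffunE.
have nz (e : dims) x : e x != 0%N -> half_plane (Z (class_of e)).
  by move=> ex; apply: stability_half_plane; apply: contra ex => /eqP ->; rewrite ffunE.
have hX : half_plane (Z (class_of (dimvec X))).
  by apply/stability_half_plane/nonzero_dimvec; case: sX.
have hd : half_plane (Z (class_of d)) by apply: (nz _ i); rewrite dE.
have hd' : half_plane (Z (class_of d')) by apply: (nz _ j); rewrite dE'.
move: lt lt'; rewrite !arg_lt // XE class_ofD raddfD !crossDr !crossvv.
by rewrite (crossC (Z (class_of d'))); lra.
Qed.

Section Uniserial.
Variable X : nilrep k n.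
Local Notation d := (dimvec X).
Variable s : 'I_n.

(** For [j <= m], the image of [v] at the vertex [j] steps above [s]. Indexing by steps avoids casts
    between vertices. *)
Fixpoint chain m : 'rV[k]_(d (iter m (@ordS n) s)) -> forall j, 'rV[k]_(d (iter j (@ordS n) s)) :=
  if m is m'.+1 then fun v j =>
    if m'.+1 == j then conform_mx 0 v
    else @chain m' (v *m mor X (iter m' (@ordS n) s)) j
  else fun v j => conform_mx 0 v.

Lemma chain_id m v : chain v m = v :> 'rV[k]_(d (iter m (@ordS n) s)).
Proof. by case: m v => [|m] v /=; rewrite ?eqxx conform_mx_id. Qed.

Lemma chain_mor m v j : (j < m)%N -> @chain m v j.+1 *m mor X (iter j (@ordS n) s) = @chain m v j.
Proof.
elim: m v j => // m IH v j; rewrite ltnS leq_eqVlt => /orP[/eqP ->|jm].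
  by rewrite chain_id /= eqn_leq ltnn /= chain_id.
by rewrite /= eqSS (gtn_eqF jm) gtn_eqF ?IH // ltnW.
Qed.

Lemma chain_pathmx m v j : (j <= m)%N -> @chain m v j *m pathmx X j s = v *m pathmx X m s.
Proof.
have base p : (p <= m)%N -> @chain m v p *m pathmx X p s = @chain m v 0 *m pathmx X 0 s.
  by elim: p => // p IH pm; rewrite -IH ?(ltnW pm) //= mulmxA chain_mor.
by move=> jm; rewrite base // -[in RHS](chain_id v) base.
Qed.

Definition offset (i : 'I_n) : nat := ((i + n - s) %% n)%N.

Lemma iter_surj (i : 'I_n) : exists2 j, (j < n)%N & i = iter j (@ordS n) s.
Proof.
have [j sj ->] := vt_window s i; exists (j - s)%N; first by lia.
by rewrite -[s in iter _ _ s]vt_val iter_ordS_vt subnKC //; lia.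
Qed.

Lemma rel_iter j : (j < n)%N -> offset (iter j (@ordS n) s) = j.
Proof.
move=> jn; rewrite /offset -[s in iter _ _ s]vt_val iter_ordS_vt vtE.
have := ltn_ord s; have := divn_eq (s + j) n; have := ltn_pmod (s + j) (ltn0Sn n').
move: (_ %/ _)%N (_ %% _)%N => p r rn E sn.
have [rs|sr] := ltnP r s.
  by rewrite (_ : (r + n - s = j)%N) ?modn_small //; case: p E => [|[|p]]; nia.
rewrite (_ : (r + n - s = j + n)%N) ?modnDr ?modn_small //.
by case: p E => [|[|p]]; nia.
Qed.

Lemma rel_arc j i : (j <= n)%N -> arc n' s (s + j) i = (offset i < j)%N.
Proof.
have [x xn ->] := iter_surj i => jn; rewrite rel_iter //.
by rewrite -[s in iter _ _ s]vt_val iter_ordS_vt arc_vt; lia.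
Qed.

Section Maximal.
Variables (l : nat) (v : 'rV[k]_(d (iter l (@ordS n) s))) (xi : 'cV[k]_(d s)).
Hypothesis path0 : forall i, pathmx X l.+1 i = 0.
Hypothesis vxi : v *m pathmx X l s *m xi != 0.

Definition chainspan m i : 'rV[k]_(d i) :=
  if (offset i < m)%N then conform_mx 0 (chain v (offset i)) else 0.

Definition cochain i : 'cV[k]_(d i) := conform_mx 0 (pathmx X (offset i) s *m xi).

(** The complement of the chain: at each of its vertices, the kernel of the functional that moves
    down to [s] and applies [xi]; elsewhere, everything. *)
Definition cochain_ker i : 'M[k]_(d i) :=
  if (offset i < l.+1)%N then kermx (cochain i) else 1%:M.

Lemma chainspanE m j : (j < n)%N ->
  chainspan m (iter j (@ordS n) s) = if (j < m)%N then chain v j else 0.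
Proof. by move=> jn; rewrite /chainspan rel_iter // conform_mx_id. Qed.

Lemma cochainE j : (j < n)%N -> cochain (iter j (@ordS n) s) = pathmx X j s *m xi.
Proof. by move=> jn; rewrite /cochain rel_iter // conform_mx_id. Qed.

Lemma chain_cochain j : (j <= l)%N -> chain v j *m (pathmx X j s *m xi) != 0.
Proof. by move=> jl; rewrite mulmxA chain_pathmx. Qed.

(** The last member of the chain is [v] after [l] arrows, so one more arrow gives zero. *)
Lemma chain_bottom : hzero (hstep (hv (chain v 0))).
Proof.
have -> : hv (chain v 0) = iter l (@hstep _ _ X) (hv v).
  by rewrite hstep_path -(chain_pathmx v (leq0n l)) /= mulmx1.
by rewrite -iterS; apply: hstep_nilpotent.
Qed.

Lemma chainspan_closed m i : (m <= l.+1)%N -> (l < n)%N ->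
  (chainspan m (ordS i) *m mor X i <= chainspan m i)%MS.
Proof.
move=> ml ln; have [j jn ->] := iter_surj i.
have [jn'|nj] := ltnP j.+1 n.
  rewrite [chainspan m (ordS _)](chainspanE m jn') chainspanE //; case: ltnP => [jm|_];
      last by rewrite mul0mx sub0mx.
  by rewrite chain_mor ?(ltnW jm) //; lia.
(* The arrow leaving [s] is the only one that does not continue the chain; [chain_bottom] covers
   it. *)
have E : s = ordS (iter j (@ordS n) s).
  by rewrite -iterS (_ : j.+1 = n) ?iter_ordS_n //; lia.
have rel0 : offset (ordS (iter j (@ordS n) s)) = 0%N.
  by rewrite -E; apply: (@rel_iter 0).
rewrite /chainspan rel0; case: ifP => _; last by rewrite mul0mx sub0mx.
set u := conform_mx _ _.
have := chain_bottom; rewrite -(hv_conform (chain v 0) E) hstep_mor => /eqP /= ->.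
exact: sub0mx.
Qed.

(** Composing the functional at step [j] with the arrow into it gives the one at step [j + 1], and
    at the end of the chain a path of [l + 1] arrows, which is zero. *)
Lemma cochain_ker_closed i : (l < n)%N ->
  (cochain_ker (ordS i) *m mor X i <= cochain_ker i)%MS.
Proof.
move=> ln; have [j jn ->] := iter_surj i.
rewrite {2}/cochain_ker rel_iter //; case: ltnP => [jl|_]; last exact: submx1.
apply/sub_kermxP; rewrite cochainE // -mulmxA [mor X _ *m _]mulmxA.
rewrite -[mor X _ *m pathmx X j s]/(pathmx X j.+1 s).
move: jl; rewrite leq_eqVlt => /orP[/eqP [->]|jl]; first by rewrite path0 mul0mx mulmx0.
have jn' : (j.+1 < n)%N by lia.
have E : cochain_ker (ordS (iter j (@ordS n) s)) = kermx (pathmx X j.+1 s *m xi).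
  by rewrite /cochain_ker (rel_iter jn' : offset (ordS _) = _) jl (cochainE jn' : cochain
      (ordS _) = _).
by rewrite E mulmx_ker.
Qed.

Lemma rank_chainspan m i : (m <= l.+1)%N -> (l < n)%N -> \rank (chainspan m i) = (offset i < m)%N.
Proof.
move=> ml ln; have [j jn ->] := iter_surj i; rewrite chainspanE // rel_iter //.
case: ltnP => jm; last by rewrite mxrank0.
have jl : (j <= l)%N by lia.
rewrite rank_rV; case: eqP => // E; have := chain_cochain jl.
by rewrite E mul0mx eqxx.
Qed.

Lemma rank_cochain_ker i : (l < n)%N ->
  (\rank (chainspan l.+1 i) + \rank (cochain_ker i))%N = d i.
Proof.
move=> ln; rewrite rank_chainspan //; have [j jn ->] := iter_surj i.
rewrite /cochain_ker rel_iter //; case: ltnP => jl; last by rewrite mxrank1.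
have c0 : cochain (iter j (@ordS n) s) != 0.
  apply/eqP => E; have := @chain_cochain j; rewrite -cochainE // E mulmx0 eqxx.
  by move/(_ jl).
rewrite mxrank_ker; suff -> : \rank (cochain (iter j (@ordS n) s)) = 1%N.
  rewrite subnKC // lt0n; apply/eqP => d0; case/eqP: c0.
  apply/matrixP => x; exfalso; have := ltn_ord x.
  by move: (nat_of_ord x) => y; rewrite d0.
by rewrite -mxrank_tr rank_rV trmx_eq0 c0.
Qed.

End Maximal.

End Uniserial.

Section PowerN.
Variable X : nilrep k n.
Local Notation d := (dimvec X).

(* The kernel of the endomorphism of X given by going once round the cycle;   *)
(* conform_mx identifies the equal vertices iter n ordS i and i.              *)
Definition loop_ker i : 'M[k]_(d i) := conform_mx 0 (kermx (pathmx X n i)).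

Let conform_kermx i i' (P : 'M[k]_(d i', d i)) : i' = i ->
  (\rank (conform_mx (0 : 'M_(d i)) (kermx P)) + \rank P)%N = d i /\
  forall u : 'rV_(d i), (u <= conform_mx (0 : 'M_(d i)) (kermx P))%MS
     = (conform_mx (0 : 'rV_(d i')) u *m P == 0).
Proof.
move=> E; case: i / E P => P; rewrite conform_mx_id mxrank_ker subnK ?rank_leq_row //.
split=> // u; rewrite conform_mx_id; exact/sub_kermxP/eqP.
Qed.

Lemma rank_loop_ker i : (\rank (pathmx X n i) + \rank (loop_ker i))%N = d i.
Proof. by rewrite addnC; case: (conform_kermx (pathmx X n i) (iter_ordS_n i)). Qed.

Lemma loop_kerP i (u : 'rV_(d i)) :
  (u <= loop_ker i)%MS = hzero (iter n (@hstep _ _ X) (hv u)).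
Proof.
have [_ ->] := conform_kermx (pathmx X n i) (iter_ordS_n i).
by rewrite -(hv_conform u (esym (iter_ordS_n i))) hstep_path.
Qed.

Lemma loop_ker_closed i : (loop_ker (ordS i) *m mor X i <= loop_ker i)%MS.
Proof.
apply/row_subP => j; rewrite row_mul loop_kerP -hstep_mor -iterSr iterS.
by apply: hzero_step; rewrite -loop_kerP row_sub.
Qed.

Lemma loop_image_closed i : (pathmx X n (ordS i) *m mor X i <= pathmx X n i)%MS.
Proof.
apply/row_subP => j; rewrite row_mul rowE.
set u := delta_mx _ _; pose y := hstep (hv u).
have [|x E] := @hstep_path_tag _ _ X n i y.
  rewrite iter_ordS_n -[tag y]/(ord_pred (iter n (@ordS n) (ordS i))) iter_ordS_n.
  exact: ordSK.
have : hv (u *m pathmx X n (ordS i) *m mor X i) = hv (x *m pathmx X n i).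
  by rewrite -E /y -hstep_mor -hstep_path; exact: (iterSr n (@hstep _ _ X) (hv u)).
by move/hv_inj ->; exact: submxMl.
Qed.

End PowerN.

Lemma stable_dimvec (X : nilrep k n) : stable Z X ->
  exists (s : 'I_n) l, [/\ (0 < l <= n)%N, dimvec X = arc n' s (s + l)
    & stab (arc_phase Z) s (s + l)].
Proof.
move=> sX; have [nX _] := sX.
have exl : exists m, [forall i, pathmx X m i == 0].
  by have [m N] := nilrepP X; exists m; apply/forallP => i; apply/eqP; exact: N.
case: (ex_minnP exl) => -[|l] /forallP path0 lmin.
  case: nX => i di; case: di; have /eqP := path0 i.
  move=> E; have := congr1 (@mxrank _ _ _) E;
      rewrite mxrank0 [pathmx _ _ _]/(1%:M) mxrank1 => E'; exact: E'.
have {}path0 i : pathmx X l.+1 i = 0 by apply/eqP.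
have [s ps] : exists s, pathmx X l s != 0.
  apply/existsP; rewrite -[X in is_true X]negbK negb_exists; apply/negP => /forallP H.
  by have := lmin l; rewrite ltnn => /(_ _)/negP; apply=> //; apply/forallP => i;
      have := H i; rewrite negbK.
have [a [b ab]] := matrix0Pn _ ps.
pose v : 'rV[k]_(dimvec X (iter l (@ordS n) s)) := delta_mx 0 a.
pose xi : 'cV[k]_(dimvec X s) := delta_mx b 0.
have vxi : v *m pathmx X l s *m xi != 0.
  rewrite -rowE -colE; apply/matrix0Pn; exists 0, 0; by rewrite !mxE.
have [ln|nl] := ltnP l n; last first.
  (* Loewy length above [n]: the image of a full turn is nonzero, so [stable_split] makes its kernel
     zero. But the kernel contains [v *m pathmx X l s]. *)
  have nz : exists i, \rank (pathmx X n i) != 0%N.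
    apply/existsP; rewrite -[X in is_true X]negbK negb_exists; apply/negP => /forallP H.
    have := lmin n; rewrite ltnNge nl => /(_ _)/negP; apply=> //.
    by apply/forallP => i; have := H i; rewrite negbK mxrank_eq0.
  have := stable_split sX (@loop_image_closed X) (@loop_ker_closed X)
    (rank_loop_ker X) nz s.
  move=> /eqP; rewrite mxrank_eq0 => /eqP K0.
  have : (v *m pathmx X l s <= loop_ker X s)%MS.
    rewrite loop_kerP -hstep_path -iterD (_ : (n + l = n' + l.+1)%N); last by lia.
    by rewrite iterD; apply/hzero_iter/hstep_nilpotent.
  rewrite K0 submx0 => /eqP E; case/eqP: vxi; by rewrite E mul0mx.
have cl m i ml := chainspan_closed path0 vxi i ml ln (m := m).
have rk := rank_chainspan vxi.
have J0 : (offset s s < 1)%N by rewrite (@rel_iter s 0).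
(* Loewy length at most [n]: the complement of the chain must vanish, so the chain spans [X]. *)
have W0 := stable_split sX (fun i => cl l.+1 i (leqnn _)) (fun i =>
    cochain_ker_closed path0 vxi i ln)
  (fun i => rank_cochain_ker vxi i ln).
have {}W0 : forall i, \rank (cochain_ker l xi i) = 0%N.
  by apply: W0; exists s; rewrite rk //; case: ltnP => //; lia.
have dE i : dimvec X i = (offset s i < l.+1)%N.
  by rewrite -(rank_cochain_ker vxi i ln) W0 addn0 rk.
have XE : dimvec X = arc n' s (s + l.+1).
  by apply/ffunP => i; rewrite dE rel_arc.
exists s, l.+1; split=> //; apply/stabP; split; first by lia.
move=> t st; have [j jt] : {j | t = (s + j)%N} by exists (t - s)%N; lia.
rewrite jt in st *; have jl : (j <= l.+1)%N by lia.
(* The lowest [j] members of the chain span the proper subobject belonging to the initial arc. *)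
have [||e eE lt] := @stable_sub X _ (chainspan v j) s (iter j (@ordS n) s) sX (fun i => cl j i jl).
- by rewrite rk //; case: ltnP => //; lia.
- by rewrite rk // dE rel_iter ?ltnn; lia.
move: lt; rewrite /arc_phase XE; congr (arg (Z (class_of _)) < _).
apply/ffunP => i; rewrite eE rk // rel_arc //; lia.
Qed.

End StableObjects.

(** * Arcs as uniserial representations and their subobjects *)

Section ArcRepresentations.
Variables (k : fieldType) (n' : nat).
Local Notation n := n'.+1.
Local Notation dims := {ffun 'I_n -> nat}.

Definition arc_rep s t : rep k n := @Rep k n (arc n' s t) (fun _ => const_mx 1).

Lemma pathmx_eq0 (X : rep k n) m j i :
  (j <= m)%N -> dimvec X (iter j (@ordS n) i) = 0%N -> pathmx X m i = 0.
Proof.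
elim: m => [|m IH]; rewrite leq_eqVlt => /orP[/eqP -> d0|jm d0].
- apply/matrixP => x; exfalso; have := ltn_ord x.
  by move: (nat_of_ord x) => y; rewrite d0.
- by [].
- apply/matrixP => x; exfalso; have := ltn_ord x.
  by move: (nat_of_ord x) => y; rewrite d0.
- by rewrite /= IH ?mulmx0.
Qed.

(** An arc shorter than [n] misses the vertex [t], and every path of [n] arrows passes through
    it. *)
Lemma arc_rep_nilpotent s t : (s < t < s + n)%N -> nilpotent_rep (arc_rep s t).
Proof.
move=> st; exists n => i; have [j jn E] := vt_window i (vt n' t).
apply: (@pathmx_eq0 _ n (j - i)); first by lia.
rewrite -[i in iter _ _ i]vt_val iter_ordS_vt subnKC; last by lia.
by rewrite -E /= arc_vt ?ltnn //; lia.
Qed.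

Definition arc_nilrep s t (st : (s < t < s + n)%N) : nilrep k n :=
  Nilrep (arc_rep_nilpotent st).

Section Subobjects.
Variables (s t : nat) (st : (s < t < s + n)%N).
Local Notation M := (arc_rep s t).
Variables (Y : rep k n) (f : forall i, 'M[k]_(dimvec Y i, dimvec M i)).
Hypotheses (fm : morphism f) (fi : injective_mor f).

Lemma sub_arc_dim j : (j < n)%N -> (dimvec Y (vt n' (s + j)) <= (s + j < t))%N.
Proof.
move=> jn; have := fi (vt n' (s + j)); rewrite /row_free => /eqP <-.
apply: leq_trans (rank_leq_col _) _.
by rewrite /= arc_vt; lia.
Qed.

(** The arrow of the arc is invertible here, so a nonzero subspace above would have a nonzero image
    below. *)
Lemma sub_arc_step j : (s + j.+1 < t)%N -> dimvec Y (vt n' (s + j)) = 0%N ->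
  dimvec Y (vt n' (s + j.+1)) = 0%N.
Proof.
move=> jt Y0; have := fm (vt n' (s + j)); set i := vt n' (s + j) in Y0 *.
have d1 : dimvec M i = 1%N by rewrite /= arc_vt; lia.
have iS : ordS i = vt n' (s + j.+1) by rewrite ordS_vt addnS.
have d2 : dimvec M (ordS i) = 1%N by rewrite iS /= arc_vt; lia.
have -> : mor Y i *m f i = 0.
  suff -> : f i = 0 by rewrite mulmx0.
  by apply/matrixP => x; exfalso; have := ltn_ord x; move: (nat_of_ord x) => y; rewrite Y0.
move=> /esym E; rewrite -iS; apply/eqP; move: (fi (ordS i)).
rewrite /row_free => /eqP <-; rewrite mxrank_eq0; apply/eqP.
have E1 : mor M i *m (const_mx 1 : 'M_(dimvec M i, dimvec M (ordS i))) = 1%:M.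
  apply/matrixP => x y; rewrite mxE (eq_bigr (fun _ => 1)) => [|z _]; last by rewrite !mxE mulr1.
  rewrite sumr_const card_ord d1 mxE; case: eqP => // -[]; apply: ord_inj.
  have := ltn_ord x; have := ltn_ord y.
  by move: (nat_of_ord x) (nat_of_ord y) => a b; rewrite d2; lia.
by rewrite -[LHS]mulmx1 -E1 mulmxA E mul0mx.
Qed.

Lemma sub_arc : exists2 j, (s + j <= t)%N & dimvec Y = arc n' s (s + j).
Proof.
have ex : exists j, (s + j == t) || (dimvec Y (vt n' (s + j)) == 0%N).
  by exists (t - s)%N; apply/orP; left; lia.
case: (ex_minnP ex) => j Hj jmin.
have jt : (s + j <= t)%N.
  by have := jmin (t - s)%N; rewrite (_ : (s + (t - s) == t)%N) => [/(_ isT)|]; lia.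
exists j => //; apply/ffunP => i; have [x sx ->] := vt_window s i.
have xE : x = (s + (x - s))%N by lia.
rewrite xE; move: (x - s)%N sx xE => p sx xE; rewrite arc_vt; [|lia|lia].
have pn : (p < n)%N by lia.
have [pj|jp] := ltnP p j.
  have := jmin p; have := sub_arc_dim pn; move: (dimvec Y _) => e; lia.
have Y0 m : (j <= m < n)%N -> dimvec Y (vt n' (s + m)) = 0%N.
  elim: m => [|m IH] jm.
    have j0 : j = 0%N by lia.
    by move: Hj; rewrite j0 => /orP[|/eqP //]; lia.
  have [mt|tm] := ltnP (s + m.+1) t; last first.
    have mn : (m.+1 < n)%N by lia.
    by have := sub_arc_dim mn; lia.
  have [jm'|jm'] := leqP j m; first by apply: sub_arc_step => //; apply: IH; lia.
  have -> : m.+1 = j by lia.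
  by move: Hj => /orP[|/eqP //]; lia.
by rewrite Y0; lia.
Qed.

End Subobjects.

Section Stable.
Variables (R : realType) (Z : {additive G0 n -> R[i]}).

Lemma arc_rep_stable s t (st : (s < t < s + n)%N) :
  stab (arc_phase Z) s t -> stable Z (arc_nilrep st).
Proof.
move=> /stabP[_ H]; split.
  by exists (vt n' s); rewrite /= arc_vt; lia.
move=> Y [i Yi] [f [fm fi nsurj]].
have [j jt YE] := sub_arc st fm fi.
have j0 : (0 < j)%N.
  by rewrite lt0n; apply/eqP => j0; apply: Yi; rewrite YE j0 addn0 arc_nil ffunE.
have jlt : (s + j < t)%N.
  rewrite ltn_neqAle jt andbT; apply/eqP => E; apply: nsurj => x.
  have dx : dimvec Y x = dimvec (arc_nilrep st) x by rewrite YE E.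
  by have := fi x; rewrite /row_free /row_full => /eqP ->; apply/eqP.
rewrite /phase YE /=; apply: H; lia.
Qed.
End Stable.

End ArcRepresentations.

(** * Discrete stability functions *)

Section Discrete.
Variables (k : fieldType) (n' : nat) (R : realType).
Local Notation n := n'.+1.
Local Notation dims := {ffun 'I_n -> nat}.
Variable Z : {additive G0 n -> R[i]}.
Hypotheses (sZ : stability_function k Z) (dZ : discrete k Z).

Lemma stable_simple_in_Amu (X : nilrep k n) : stable Z X -> simple_in_Amu Z (phase Z X) X.
Proof.
move=> [nX sX]; split=> //.
  by right; split=> //; split=> // Y nY pY; apply/ltW/sX.
move=> Y [//|[_ E]] nY pY; have := sX Y nY pY; by rewrite E ltxx.
Qed.

(** Both objects are simple in the same subcategory of fixed phase, which has one simple object.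
    Stable objects are thus identified by their dimension vectors. *)
Lemma stable_iso (X Y : nilrep k n) : stable Z X -> stable Z Y ->
  phase Z X = phase Z Y -> iso_rep X Y.
Proof.
move=> sX sY E; have [_ mu] := sZ (proj1 sX).
have [/(_ X)|[S [_ HS]]] := dZ mu.
  by case: (stable_simple_in_Amu sX) => nX AX _ /(_ AX).
apply: (@iso_common _ _ _ _ S); apply: HS; first exact: stable_simple_in_Amu.
rewrite E; exact: stable_simple_in_Amu.
Qed.

Local Notation ph := (arc_phase Z).

Lemma stab_arc_inj a b a' b' : stab ph a b -> stab ph a' b' ->
  (b < a + n)%N -> (b' < a' + n)%N -> ph a b = ph a' b' -> arc n' a b = arc n' a' b'.
Proof.
move=> st st' bn bn' E; have [ab _] := stabP _ _ _ st; have [ab' _] := stabP _ _ _ st'.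
have h : (a < b < a + n)%N by rewrite ab.
have h' : (a' < b' < a' + n)%N by rewrite ab'.
have := stable_iso (arc_rep_stable k h st) (arc_rep_stable k h' st') E.
exact: iso_dimvec.
Qed.

Lemma stab_shift_mul r a b : stab ph (a + r * n) (b + r * n) = stab ph a b.
Proof.
elim: r => [|r IH]; first by rewrite !mul0n !addn0.
by rewrite mulSn [(n + _)%N]addnC !addnA stab_shift.
Qed.

Lemma arc_shift_mul r a b : arc n' (a + r * n) (b + r * n) = arc n' a b.
Proof.
elim: r => [|r IH]; first by rewrite !mul0n !addn0.
by rewrite mulSn [(n + _)%N]addnC !addnA arc_shift.
Qed.

Variable c : nat.
Hypothesis nc : (n <= c)%N.
Hypothesis cut : forall t, (c < t < c + n)%N -> ph c t < ph c (c + n).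

Definition stable_arc (p : nat * nat) :=
  [&& (c <= p.1)%N, (p.2 <= c + n)%N, stab ph p.1 p.2 & p != (c, c + n)%N].

Lemma stable_arc_bounds p : stable_arc p ->
  [/\ (c <= p.1 < p.2)%N, (p.2 <= c + n)%N & (p.2 < p.1 + n)%N].
Proof.
case: p => s t /and4P[/= cs tc /stabP[st _] ne]; split=> //; first by rewrite cs.
move: ne; rewrite xpair_eqE; lia.
Qed.

(** The arc of [X] is translated by whole turns until it starts in the window; [stab_no_crossing]
    keeps its end there. *)
Lemma stable_dimvec_arc (X : nilrep k n) : stable Z X -> dimvec X <> delta n ->
  exists2 p, stable_arc p & dimvec X = arc n' p.1 p.2.
Proof.
move=> sX nd; have [s [l [ln XE st]]] := stable_dimvec sZ sX.
have ln' : (l < n)%N.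
  case: (ltngtP l n) => // E; first by lia.
  by case: nd; rewrite XE E arc_full.
have [r rc] : exists r, (c <= s + r * n < c + n)%N.
  have [j jc /esym/eqP] := vt_window c (vt n' s); rewrite vt_eq => /eqP E.
  exists (j %/ n)%N; rewrite addnC -[X in (_ + X)%N](modn_small (ltn_ord s)) -E.
  by rewrite -divn_eq.
pose p := (s + r * n, s + l + r * n)%N.
have stp : stab ph p.1 p.2 by rewrite stab_shift_mul.
have pn : (p.2 < p.1 + n)%N by rewrite /=; lia.
exists p; last by rewrite arc_shift_mul.
apply/and4P; split=> //; first by case/andP: rc.
  apply: (stab_no_crossing (Z := Z)) cut rc pn stp; exact: stability_half_plane sZ.
by rewrite xpair_eqE; lia.
Qed.

Lemma stable_arc_dim_inj p p' : stable_arc p -> stable_arc p' ->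
  arc n' p.1 p.2 = arc n' p'.1 p'.2 -> p = p'.
Proof.
move=> /stable_arc_bounds[h1 h2 _] /stable_arc_bounds[h1' h2' _].
by move=> /(arc_inj h1 h2 h1' h2'); case: p p' {h1 h2 h1' h2'} => [s t] [s' t'].
Qed.

(** Passing to dimension vectors turns any enumeration of stable objects into the decreasing list of
    stable arcs of the window, to which the combinatorial results apply. *)
Lemma enumeration_arcs m (L : 'I_m -> nilrep k n) : stable_enumeration Z L ->
  exists Ls, [/\ forall p, (p \in Ls) = stable_arc p,
    pairwise (fun x y => ph y.1 y.2 < ph x.1 x.2) Ls
    & @arc_prod k n' Ls = \prod_(a < m) qdilog k (dimvec (L a))].
Proof.
case=> stL allL srt.
have /choice[f fP] : forall a, exists p, stable_arc p /\ dimvec (L a) = arc n' p.1 p.2.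
  move=> a; have [sa na] := stL a; have [p ? ?] := stable_dimvec_arc sa na.
  by exists p.
exists [seq f a | a <- enum 'I_m]; split.
- move=> p; apply/mapP/idP => [[a _ ->]|sp]; first by case: (fP a).
  have [h1 h2 h3] := stable_arc_bounds sp; have /and4P[_ _ st _] := sp.
  have h : (p.1 < p.2 < p.1 + n)%N by lia.
  have nd : dimvec (arc_nilrep k h) <> delta n.
    rewrite /= -(arc_full n' c) => E.
    have cc : (c <= c < c + n)%N by lia.
    have [E1 E2] := arc_inj h1 h2 cc (leqnn _) E.
    by case/and4P: sp => _ _ _ /eqP; apply; rewrite [LHS]surjective_pairing E1 E2.
  have [a [iso _]] := allL _ (arc_rep_stable k h st) nd.
  exists a; first by rewrite mem_enum.
  apply: stable_arc_dim_inj => //; first by case: (fP a).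
  by have [_ <-] := fP a; rewrite -(iso_dimvec iso).
- rewrite pairwise_map; have : pairwise (relpre val ltn) (enum 'I_m).
    by rewrite -(pairwise_map val) val_enum_ord -(sorted_pairwise ltn_trans) iota_ltn_sorted.
  apply: sub_pairwise => a b /= ab; have := srt a b ab.
  by rewrite /phase (proj2 (fP a)) (proj2 (fP b)).
- rewrite /arc_prod big_map enumT [index_enum _]unlock; apply: eq_bigr => a _.
  by have [_ <-] := fP a.
Qed.

Lemma exists_enumeration : exists (m : nat) (L : 'I_m -> nilrep k n), stable_enumeration Z L.
Proof.
have /choice[g gP] : forall p : nat * nat, exists X : nilrep k n,
    stable_arc p -> stable Z X /\ dimvec X = arc n' p.1 p.2.
  move=> p; have [sp|nsp] := boolP (stable_arc p); last first.
    by exists (Nilrep (zero_rep_nilpotent k 0)).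
  have [h1 h2 h3] := stable_arc_bounds sp; have /and4P[_ _ st _] := sp.
  have h : (p.1 < p.2 < p.1 + n)%N by lia.
  by exists (arc_nilrep k h) => _; split; [exact: arc_rep_stable|].
pose geph (x y : nat * nat) := ph y.1 y.2 <= ph x.1 x.2.
pose I := index_iota c (c + n).+1.
pose Ls := sort geph [seq p <- [seq (a, b) | a <- I, b <- I] | stable_arc p].
have LsE p : (p \in Ls) = stable_arc p.
  rewrite mem_sort mem_filter; case: (boolP (stable_arc p)) => // sp.
  have [h1 h2 h3] := stable_arc_bounds sp; case: p sp h1 h2 h3 => s t sp h1 h2 h3.
  by rewrite /= in h1 h2 h3; apply: allpairs_f; rewrite mem_index_iota; lia.
have Lsu : uniq Ls.
  by rewrite sort_uniq filter_uniq // allpairs_uniq ?iota_uniq // => -[a b] [a' b'] _ _.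
have Lss : pairwise geph Ls.
  rewrite -sorted_pairwise; last by move=> x y t h1 h2; apply: le_trans h2 h1.
  by apply: sort_sorted => x y; rewrite /geph; exact: le_total.
pose x0 := (0%N, 0%N).
have LP (a : 'I_(size Ls)) : stable_arc (nth x0 Ls a) by rewrite -LsE mem_nth.
have gA (a : 'I_(size Ls)) := gP _ (LP a).
exists (size Ls), (fun a => g (nth x0 Ls a)); split.
- move=> a; have [st dE] := gA a; split=> //; rewrite dE -(arc_full n' c) => E.
  have [h1 h2 h3] := stable_arc_bounds (LP a).
  have cc : (c <= c < c + n)%N by lia.
  by have [E1 E2] := arc_inj h1 h2 cc (leqnn _) E; lia.
- move=> X sX nd; have [p sp XE] := stable_dimvec_arc sX nd.
  have pL : (index p Ls < size Ls)%N by rewrite index_mem LsE.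
  exists (Ordinal pL); split=> [|a iso].
    rewrite /= nth_index ?LsE //; have [st dE] := gP _ sp.
    by apply: stable_iso => //; rewrite /phase XE dE.
  apply: val_inj => /=; have [_ dE] := gA a.
  have -> : p = nth x0 Ls a.
    by apply: stable_arc_dim_inj => //; rewrite -XE -dE; exact: iso_dimvec.
  by rewrite index_uniq.
- move=> a b ab; have [sa aE] := gA a; have [sb bE] := gA b.
  have le : phase Z (g (nth x0 Ls b)) <= phase Z (g (nth x0 Ls a)).
    rewrite /phase aE bE; have /(pairwiseP x0) := Lss.
    by apply; rewrite ?inE.
  (* Sorting gives only weak inequalities; equal phases would mean isomorphic objects, hence equal
     arcs in a list without repetitions. *)
  rewrite lt_neqAle le andbT; apply/eqP => E.
  have ABE : nth x0 Ls a = nth x0 Ls b.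
    apply: stable_arc_dim_inj => //; rewrite -aE -bE.
    by apply/iso_dimvec/stable_iso.
  by move/eqP: ABE; rewrite nth_uniq // => /eqP; lia.
Qed.

End Discrete.

(** * The system satisfied by the product over stable objects, and independence of the stability
    function *)

Lemma EZ_system (k : fieldType) n' (R : realType) (Z : {additive G0 n'.+1 -> R[i]})
    (E : qtring k n'.+1) :
    stability_function k Z -> discrete k Z -> is_EZ k Z E ->
  (forall i, scaleby (coord i) E = topV k i * E) /\ E 0 = 1.
Proof.
move=> sZ dZ [m [L [en EE]]]; have Zpos := stability_half_plane sZ.
have disc := stab_arc_inj sZ dZ.
have [c nc cut] := exists_cut Zpos disc.
have [Ls [LsE srt prodE]] := enumeration_arcs sZ nc cut en.
have {}EE : E = @arc_prod k n' Ls by rewrite prodE EE.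
have sw := arc_phase_seesaw Zpos.
have LsE' s t : ((s, t) \in Ls) = [&& (c <= s)%N, (t <= c + n'.+1)%N,
    stab (arc_phase Z) s t & (s, t) != (c, c + n'.+1)%N] by rewrite LsE.
rewrite EE; split; first exact: (arc_prod_system k sw nc cut LsE' srt).
exact: (arc_prod_coef0 k nc LsE' srt).
Qed.

Lemma EZ_unique (k : fieldType) n' (R : realType) (Z Z' : {additive G0 n'.+1 -> R[i]})
    (E E' : qtring k n'.+1) :
    stability_function k Z -> discrete k Z -> stability_function k Z' -> discrete k Z' ->
  is_EZ k Z E -> is_EZ k Z' E' -> E = E'.
Proof.
move=> sZ dZ sZ' dZ' /(EZ_system sZ dZ)[sysE E0] /(EZ_system sZ' dZ')[sysE' E0'].
apply: subr0_eq; apply: (scaleby_system_eq0 (V := @topV k n')).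
- exact: topV_coef0.
- by move=> i; rewrite scalebyB sysE sysE' mulrBr.
- by rewrite subqE E0 E0' subrr.
Qed.

Theorem theorem3p3 (k : finFieldType) (n : nat) (hn : (1 <= n)%N)
    (R : realType) (Z Z' : {additive G0 n -> R[i]})
    (sZ : stability_function k Z) (dZ : discrete k Z)
    (sZ' : stability_function k Z') (dZ' : discrete k Z') :
  (exists E : qtorus n, is_EZ k Z E) /\
  (forall E E' : qtorus n, is_EZ k Z E -> is_EZ k Z' E' -> E = E').
Proof.
case: n hn Z Z' sZ dZ sZ' dZ' => // n' _ Z Z' sZ dZ sZ' dZ'; split.
  have [c nc cut] := exists_cut (stability_half_plane sZ) (stab_arc_inj sZ dZ).
  have [m [L en]] := exists_enumeration sZ dZ nc cut.
  by eexists; exists m, L; split; first exact: en.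
by move=> E E'; exact: (EZ_unique sZ dZ sZ' dZ').
Qed.
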